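(* Let $X$ be a Gromov-hyperbolic metric space with a basepoint $o\in X$, and let $\mu$ be a discrete non-elementary probability measure on the set of isometries of $X$. Let $g_0,g_1,\dots$ be independent random isometries with distribution $\mu$, and let $Z_n=g_0\cdots g_{n-1}$. Then there exists $\kappa>0$ such that, for all $n$, $$\mathbb{P}\big(d(o,Z_n\cdot o)\leq \kappa n\big)\leq e^{-\kappa n}.$$
   Context: Gromov-hyperbolic: a metric space $X$ such that for some $\delta\geq 0$, for all $x,y,z,a\in X$, $(x,z)_a\geq \min((x,y)_a,(y,z)_a)-\delta$, where $(x,z)_y=\frac12(d(x,y)+d(y,z)-d(x,z))$ is the Gromov product. No geodesicity, properness or separability is assumed. Isometries are bijective isometries of $X$ (they form a group). A discrete probability measure is one that is supported on a countable set (a sum of atoms). $\mu$ is non-elementary if the semigroup generated by the support of $\mu$ contains two loxodromic elements with disjoint sets of fixed points at infinity (in $\partial X$). No moment condition is assumed on $\mu$. *)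

(* Defs.v *)
From HB Require Import structures.
From mathcomp Require Import all_boot all_order all_algebra finmap.
From mathcomp Require Import all_classical all_reals all_analysis.

Set Implicit Arguments.
Unset Strict Implicit.
Unset Printing Implicit Defensive.

Import Order.TTheory GRing.Theory Num.Theory.
Import numFieldNormedType.Exports.

Local Open Scope classical_set_scope.
Local Open Scope ring_scope.

(* [gromov_product y x z] is (x, z)_y: the basepoint comes first. *)
Definition gromov_product (R : realType) (X : metricType R) (y x z : X) : R :=
  (mdist x y + mdist y z - mdist x z) / 2.

Definition gromov_hyperbolic (R : realType) (X : metricType R) : Prop :=
  exists2 delta : R, 0 <= delta &
    forall x y z a : X,
      Num.min (gromov_product a x y) (gromov_product a y z) - delta
        <= gromov_product a x z.

Record Isom (R : realType) (X : metricType R) := MkIsom {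
  isom_fun :> X -> X ;
  isom_bij : bijective isom_fun ;
  isom_dist : forall x y, mdist (isom_fun x) (isom_fun y) = mdist x y
}.

Section isom_group.
Context {R : realType} {X : metricType R}.
Implicit Types f g h : Isom X.

Lemma isom_ext f g : (f : X -> X) =1 g -> f = g.
Proof.
case: f g => [f bf df] [g bg dg] /= /funext fg.
by case: _ / fg in bg dg *; congr MkIsom; exact: Prop_irrelevance.
Qed.

Let one_dist (x y : X) : mdist (id x) (id y) = mdist x y.
Proof. by []. Qed.

Definition isom_one : Isom X :=
  MkIsom (Bijective (fun=> erefl) (fun=> erefl)) one_dist.

Let mul_dist f g (x y : X) : mdist ((f \o g) x) ((f \o g) y) = mdist x y.
Proof. by rewrite /= !isom_dist. Qed.

Definition isom_mul f g : Isom X :=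
  MkIsom (bij_comp (isom_bij f) (isom_bij g)) (mul_dist f g).

Lemma isom_inv_subproof f :
  {h : X -> X | cancel f h /\ cancel h f}.
Proof. by apply: cid; case: (isom_bij f) => h fK hK; exists h. Qed.

Let inv_fun f : X -> X := sval (isom_inv_subproof f).

Let inv_bij f : bijective (inv_fun f).
Proof. by rewrite /inv_fun; case: isom_inv_subproof => h /= [fK hK]; exists f. Qed.

Let inv_dist f (x y : X) : mdist (inv_fun f x) (inv_fun f y) = mdist x y.
Proof.
rewrite /inv_fun; case: isom_inv_subproof => h /= [fK hK].
by rewrite -(isom_dist f) !hK.
Qed.

Definition isom_inv f : Isom X := MkIsom (inv_bij f) (@inv_dist f).

HB.instance Definition _ := gen_eqMixin (Isom X).
HB.instance Definition _ := gen_choiceMixin (Isom X).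

Let mulA : associative isom_mul.
Proof. by move=> f g h; exact: isom_ext. Qed.

Let mul1 : left_id isom_one isom_mul.
Proof. by move=> f; exact: isom_ext. Qed.

Let mulr1 : right_id isom_one isom_mul.
Proof. by move=> f; exact: isom_ext. Qed.

Let mulV : left_inverse isom_one isom_inv isom_mul.
Proof.
move=> f; apply: isom_ext => x /=; rewrite /inv_fun.
by case: isom_inv_subproof => h /= [].
Qed.

Let mulrV : right_inverse isom_one isom_inv isom_mul.
Proof.
move=> f; apply: isom_ext => x /=; rewrite /inv_fun.
by case: isom_inv_subproof => h /= [].
Qed.

HB.instance Definition _ := isGroup.Build (Isom X)
  mulA mul1 mulr1 mulV mulrV.

HB.instance Definition _ := isPointed.Build (Isom X) isom_one.

(* The set of isometries carries the sigma-algebra of all its subsets, on which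
   a sum of atoms is always defined. *)
HB.instance Definition _ := @isMeasurable.Build default_measure_display
  (Isom X) discrete_measurable discrete_measurable0
  discrete_measurableC discrete_measurableU.

End isom_group.

Definition expgz (G : groupType) (g : G) (k : int) : G :=
  match k with Posz n => g ^+ n | Negz n => g ^- n.+1 end%g.

(* [k |-> g ^ k o] is a quasi-isometric embedding of the integers in [X]. *)
Definition loxodromic (R : realType) (X : metricType R) (o : X)
    (g : Isom X) : Prop :=
  exists L C : R, [/\ 1 <= L, 0 <= C & forall m n : int,
    `|m - n|%:~R / L - C <= mdist (expgz g m o) (expgz g n o)
      <= L * `|m - n|%:~R + C].

(* (u_m, v_n)_o tends to infinity as m and n do *)
Definition gromov_asymptotic (R : realType) (X : metricType R) (o : X)
    (u v : nat -> X) : Prop :=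
  gromov_product o (u p.1) (v p.2) @[p --> (\oo, \oo)] --> +oo.

Definition gromov_sequence (R : realType) (X : metricType R) (o : X)
    (u : nat -> X) : Prop := gromov_asymptotic o u u.

(* A point at infinity is an equivalence class of Gromov sequences. *)
Definition gromov_class (R : realType) (X : metricType R) (o : X)
    (u : nat -> X) : set (nat -> X) :=
  [set v | gromov_sequence o v /\ gromov_asymptotic o u v].

Definition gromov_boundary (R : realType) (X : metricType R) (o : X) :
    set (set (nat -> X)) :=
  gromov_class o @` gromov_sequence o.

Definition boundary_action (R : realType) (X : metricType R)
    (g : Isom X) (xi : set (nat -> X)) : set (nat -> X) :=
  [set g \o u | u in xi].

Definition fixed_at_infinity (R : realType) (X : metricType R) (o : X)
    (g : Isom X) : set (set (nat -> X)) :=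
  [set xi | gromov_boundary o xi /\ boundary_action g xi = xi].

Definition generated_semigroup (G : groupType) (A : set G) : set G :=
  smallest [set B : set G | forall f g, B f -> B g -> B (f * g)%g] A.

Definition discrete_probability (R : realType) (X : metricType R)
    (mu : probability (Isom X) R) : Prop :=
  exists2 S : set (Isom X), countable S & mu S = 1%E.

(* The support of a discrete measure. *)
Definition atoms (R : realType) (X : metricType R)
    (mu : probability (Isom X) R) : set (Isom X) :=
  [set g | (0 < mu [set g])%E].

Definition non_elementary (R : realType) (X : metricType R) (o : X)
    (mu : probability (Isom X) R) : Prop :=
  exists u v : Isom X,
    [/\ generated_semigroup (atoms mu) u, generated_semigroup (atoms mu) v,
        loxodromic o u, loxodromic o v &
        fixed_at_infinity o u `&` fixed_at_infinity o v = set0].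

Definition independent_rvs (R : realType) (d d' : measure_display)
    (Omega : measurableType d) (T : measurableType d')
    (P : probability Omega R) (g : nat -> {RV P >-> T}) : Prop :=
  forall (J : {fset nat}) (B : nat -> set T),
    (forall i, i \in J -> measurable (B i)) ->
    P (\bigcap_(i in [set` J]) (g i @^-1` B i)) =
      (\prod_(i <- J) P (g i @^-1` B i))%E.

(* The product of isometries is composition, so this is g_0 o ... o g_(n-1).
   On an arbitrary probability space, {w | d(o, Z_n w o) <= r} need only be
   measurable up to a P-null set (a product of power-set sigma-algebras may be
   smaller than the power set of the product), so its probability has to be
   taken in the completion of P, i.e. with the outer measure [P^*%mu], which
   agrees with [P] on measurable sets. *)
Definition random_walk (R : realType) (X : metricType R) (d : measure_display)
    (Omega : measurableType d) (P : probability Omega R)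
    (g : nat -> {RV P >-> Isom X}) (n : nat) (w : Omega) : Isom X :=
  (\prod_(i < n) g i w)%g.

(* Main.v *)
Require Import Defs.
From HB Require Import structures.
From mathcomp Require Import all_boot all_order all_algebra finmap.
From mathcomp Require Import all_classical all_reals all_analysis.
From mathcomp Require Import ring lra zify.

Import Order.TTheory GRing.Theory Num.Theory.
Import numFieldNormedType.Exports.

Local Open Scope classical_set_scope.
Local Open Scope ring_scope.

(** The proof is an energy estimate for the kernel [K(x, y) = exp (- d(x, y))]. To a finite
    positive measure [l] on [X] is attached its energy, the integral of [K] against
    [l x l]; it is invariant under isometries. It suffices to bound the expectation of
    [K(o, Z_n o)] by [C r^n] with [r < 1], for then Markov's inequality gives
    [P(d(o, Z_n o) <= kappa n) <= C exp (kappa n) r^n].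

    Suppose first that [X] is a tree. Then [K] is positive definite and the square root of the
    energy is a norm on measures, which a convolution on the left by a probability measure
    does not increase. If [s_1, ..., s_N] is a Schottky family, convolution by its
    uniform measure decreases this norm by a definite factor: for [i <> j] the elements
    [s_i] and [s_j] move [x] and [y] away from each other, unless [x] lies in the region
    of points that [s_i] may bring closer to [o], or [y] in that of [s_j]; these regions are
    disjoint, so by Cauchy-Schwarz the exceptions are negligible for large [N]. Some
    convolution power of [mu] charges all elements of a Schottky family, hence decreases the
    norm by a definite factor. The steps outside the family may move [o] arbitrarily far: they
    act as isometries for the norm.

    In a general hyperbolic space [K] need not be positive definite, but Cauchy-Schwarz persists
    for positive measures up to a factor that depends only on the hyperbolicity constant
    ([pairing_decay_le]). As the energy of the Schottky average can be made arbitrarily small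
    ([schottky_energy], [schottky_contraction]), it can be made to beat this factor. The
    square root of the energy is replaced by a quantity that is subadditive, the best
    constant in a bound of the pairing with arbitrary test measures ([dominated]); it is
    contracted by blocks of steps ([dominated_contraction]), which gives the exponential decay
    ([expected_decay]).

    A Schottky family is made of the elements [u^(i M) v^T u^((N - i) M)], [i < N], where [u]
    and [v] are the two given loxodromic elements: having no common fixed point at infinity
    bounds the Gromov products between the orbits of [u^+-1] and [v^+-1]
    ([orbit_ends_gp_bounded]). All measures are finitely supported: [mu] is truncated to a
    finite set of steps, with bounds that do not depend on this set. *)

(** * Gromov products and pairings of finite measures *)

Section GromovProduct.
Context {R : realType} {X : metricType R}.
Implicit Types (a b x y z : X) (f : Isom X).
Local Notation gp := gromov_product.

Lemma gpE a x y : gp a x y = (mdist a x + mdist a y - mdist x y) / 2.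
Proof. by rewrite /gromov_product (metric_sym x a). Qed.

Lemma gpC a x y : gp a x y = gp a y x.
Proof. by rewrite !gpE (metric_sym x y) (addrC (mdist a x)). Qed.

Lemma gp_ge0 a x y : 0 <= gp a x y.
Proof. by rewrite gpE; have := metric_triangle x a y; rewrite (metric_sym x a); lra. Qed.

Lemma gp_le_dist a x y : gp a x y <= mdist a x.
Proof. by rewrite gpE; have := metric_triangle a x y; lra. Qed.

Lemma gp_isom f a x y : gp (f a) (f x) (f y) = gp a x y.
Proof. by rewrite /gromov_product !isom_dist. Qed.

Lemma gp_base a b x y : gp a x y <= gp b x y + mdist a b.
Proof.
by rewrite !gpE; have := metric_triangle a b x; have := metric_triangle a b y; lra.
Qed.

Lemma gp_move a x x' y : gp a x y <= gp a x' y + mdist x x'.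
Proof.
rewrite !gpE; have := metric_triangle a x' x; have := metric_triangle x' x y.
rewrite (metric_sym x' x); lra.
Qed.

Lemma gp_add a x y : gp a x y + gp x a y = mdist a x.
Proof. by rewrite !gpE (metric_sym x a); lra. Qed.

Definition hyperbolic_constant (delta : R) : Prop :=
  forall x y z a, Num.min (gp a x y) (gp a y z) - delta <= gp a x z.

Variable delta : R.
Hypothesis hyp : hyperbolic_constant delta.

Lemma gp_trans t a x y z : t <= gp a x y -> t <= gp a y z -> t - delta <= gp a x z.
Proof.
move=> txy tyz; apply: le_trans (hyp x y z a).
by rewrite lerD2r le_min txy tyz.
Qed.

End GromovProduct.
Arguments hyperbolic_constant {R} X delta.

Section Energy.
Context {R : realType} {X : metricType R}.
Implicit Types (x y : X) (l m : seq (R * X)) (k : X -> X -> R).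

(** A finite positive measure on [X] is a list of weighted points; nothing forbids
    repetitions, so that sums of measures and images under maps are plain list
    operations. *)
Definition nonneg_weights {T : Type} (l : seq (R * T)) : bool :=
  all (fun p => 0 <= p.1) l.

Lemma nonneg_weightsP {T : eqType} (l : seq (R * T)) :
  reflect (forall p, p \in l -> 0 <= p.1) (nonneg_weights l).
Proof. by apply: (iffP allP) => l0 p /l0. Qed.

Definition pairing k l m : R :=
  \sum_(p <- l) \sum_(q <- m) p.1 * q.1 * k p.2 q.2.

Lemma pairing_flip k l m : pairing k l m = pairing (fun x y => k y x) m l.
Proof.
rewrite /pairing exchange_big /=; apply: eq_bigr => p _; apply: eq_bigr => q _.
by rewrite (mulrC p.1).
Qed.

Lemma pairing_ge0 k l m : (forall x y, 0 <= k x y) ->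
  nonneg_weights l -> nonneg_weights m -> 0 <= pairing k l m.
Proof.
move=> k0 /nonneg_weightsP l0 /nonneg_weightsP m0.
rewrite /pairing big_seq; apply: sumr_ge0 => p pl.
by rewrite big_seq; apply: sumr_ge0 => q qm; rewrite !mulr_ge0 ?(l0 p) ?(m0 q).
Qed.

Lemma ler_pairing k k' l m :
  (forall p q, p \in l -> q \in m -> k p.2 q.2 <= k' p.2 q.2) ->
  nonneg_weights l -> nonneg_weights m -> pairing k l m <= pairing k' l m.
Proof.
move=> kk' /nonneg_weightsP l0 /nonneg_weightsP m0; rewrite /pairing big_seq [leRHS]big_seq.
apply: ler_sum => p pl; rewrite big_seq [leRHS]big_seq; apply: ler_sum => q qm.
by rewrite ler_wpM2l ?kk'// mulr_ge0 ?(l0 p) ?(m0 q).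
Qed.

Definition reweight (w : X -> R) l : seq (R * X) := [seq (w p.2 * p.1, p.2) | p <- l].

Lemma pairing_reweight k w v l m :
  pairing k (reweight w l) (reweight v m) = pairing (fun x y => w x * v y * k x y) l m.
Proof.
rewrite /pairing big_map; apply: eq_bigr => p _; rewrite big_map.
by apply: eq_bigr => q _ /=; lra.
Qed.

Lemma nonneg_reweight w l : (forall x, 0 <= w x) ->
  nonneg_weights l -> nonneg_weights (reweight w l).
Proof.
move=> w0 /allP l0; apply/allP => _ /mapP[p pl ->] /=.
by rewrite mulr_ge0 ?w0//; exact: l0.
Qed.

Lemma pairingZ c k l m : pairing (fun x y => c * k x y) l m = c * pairing k l m.
Proof.
rewrite /pairing mulr_sumr; apply: eq_bigr => p _; rewrite mulr_sumr.
by apply: eq_bigr => q _; rewrite mulrCA.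
Qed.

Lemma pairing_sum (J : finType) (k : J -> X -> X -> R) l m :
  pairing (fun x y => \sum_j k j x y) l m = \sum_j pairing (k j) l m.
Proof.
rewrite /pairing [RHS]exchange_big; apply: eq_bigr => p _ /=.
rewrite [RHS]exchange_big; apply: eq_bigr => q _ /=.
by rewrite mulr_sumr.
Qed.

Definition mass_where (r : pred X) (l : seq (R * X)) : R :=
  \sum_(p <- l | r p.2) p.1.

Lemma ler_mass_where (r s : pred X) l : nonneg_weights l ->
  (forall x, r x -> s x) -> mass_where r l <= mass_where s l.
Proof.
move=> /nonneg_weightsP l0 rs; rewrite /mass_where big_mkcond [leRHS]big_mkcond /=.
rewrite big_seq [leRHS]big_seq; apply: ler_sum => p pl.
case: ifP => [rp|_]; first by rewrite (rs _ rp).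
by case: ifP => // _; exact: l0.
Qed.

Lemma pairing_rel (r : rel X) l m :
  pairing (fun x y => (r x y)%:R) l m = \sum_(q <- m) q.1 * mass_where (r^~ q.2) l.
Proof.
rewrite pairing_flip /pairing; apply: eq_bigr => q _.
rewrite /mass_where mulr_sumr [RHS]big_mkcond /=; apply: eq_bigr => p _.
by case: (r _ _); rewrite ?mulr1 ?mulr0.
Qed.

(** For an equivalence relation [r] this follows from [2 a b <= a^2 + b^2] in each
    class. In general, compare for each [y] the [l]-mass of the [r]-neighbours of
    [y] with the [m]-mass of its [r']-neighbours. Where the second is the larger one,
    the sum over [y] is at most the [r']-energy of [m]. The other points [y] are
    bad; a point [x] with a bad neighbour [y] satisfies, by [r o r <= r'],
    [m(r x) <= m(r' y) < l(r y) <= l(r' x)], so that these pairs contribute at most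
    the [r']-energy of [l]. *)
Lemma pairing_rel_le (r r' : rel X) l m :
  (forall x y, r x y = r y x) -> (forall x y, r' x y = r' y x) ->
  (forall x y z, r x y -> r y z -> r' x z) ->
  nonneg_weights l -> nonneg_weights m ->
  pairing (fun x y => (r x y)%:R) l m <=
  pairing (fun x y => (r' x y)%:R) l l + pairing (fun x y => (r' x y)%:R) m m.
Proof.
move=> rC r'C rr' l0 m0.
pose bad y := mass_where (r'^~ y) m < mass_where (r^~ y) l.
rewrite [leLHS]pairing_rel (bigID (fun q => bad q.2)) /=; apply: lerD; last first.
  rewrite pairing_rel [leRHS](bigID (fun q => bad q.2)) /=.
  rewrite -[leLHS]add0r; apply: lerD.
    rewrite big_seq_cond; apply: sumr_ge0 => q /andP[qm _].
    rewrite mulr_ge0 ?(nonneg_weightsP _ m0)//.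
    rewrite /mass_where big_seq_cond; apply: sumr_ge0 => p /andP[pm _].
    exact: (nonneg_weightsP _ m0).
  rewrite big_seq_cond [leRHS]big_seq_cond; apply: ler_sum => q /andP[qm].
  rewrite /bad -leNgt => qbad; rewrite ler_wpM2l// ?(nonneg_weightsP _ m0)//.
rewrite [leRHS]pairing_rel.
have -> : \sum_(q <- m | bad q.2) q.1 * mass_where (r^~ q.2) l =
  \sum_(p <- l) p.1 * mass_where [pred y | r p.2 y & bad y] m.
  rewrite /mass_where; under eq_bigr do rewrite mulr_sumr.
  under [RHS]eq_bigr do rewrite mulr_sumr.
  rewrite (exchange_big_dep predT) //=; apply: eq_bigr => p _.
  rewrite big_mkcond [RHS]big_mkcond /=; apply: eq_bigr => q _.
  by rewrite andbC; case: ifP => // _; rewrite mulrC.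
rewrite big_seq [leRHS]big_seq; apply: ler_sum => p pl.
rewrite ler_wpM2l ?(nonneg_weightsP _ l0)//.
have [/hasP[q qm /= /andP[rpq bq]]|nobad] :=
    boolP (has (fun q => r p.2 q.2 && bad q.2) m); last first.
  rewrite {1}/mass_where big_seq_cond big1; last first.
    move=> q /= /andP[qm rb]; case/negP: nobad; apply/hasP; exists q => //.
  rewrite /mass_where big_seq_cond; apply: sumr_ge0 => q /andP[ql _].
  exact: (nonneg_weightsP _ l0).
apply: le_trans (_ : mass_where (r'^~ q.2) m <= _).
  apply: ler_mass_where => // z /= /andP[rpz _].
  by apply: (rr' _ p.2) => //; rewrite rC.
apply: le_trans (ltW bq) _; apply: ler_mass_where => // z /= rzq.
by apply: rr' rzq _; rewrite rC.
Qed.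

End Energy.

(** * Cauchy-Schwarz for the kernel exp(-d) *)

Section CauchySchwarz.
Context {R : realType} {X : metricType R}.
Implicit Types (x y : X) (l m : seq (R * X)).
Local Notation gp := gromov_product.

Definition decay x y : R := expR (- mdist x y).
Definition energy l : R := pairing decay l l.

Lemma decayC x y : decay x y = decay y x.
Proof. by rewrite /decay metric_sym. Qed.

Lemma decay_ge0 x y : 0 <= decay x y.
Proof. exact: expR_ge0. Qed.

Lemma energy_ge0 l : nonneg_weights l -> 0 <= energy l.
Proof. by move=> l0; apply: pairing_ge0 => // x y; exact: decay_ge0. Qed.

Definition cs_constant (delta : R) : R := 2 * expR (4 * (delta + 1)).

Lemma cs_constant_gt0 delta : 0 < cs_constant delta.
Proof. by rewrite mulr_gt0 ?expR_gt0. Qed.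

(** The two inequalities below compare [exp (2 s)] with a geometric sum over the levels
    [j * h <= s]. In the second one the level is lowered by one, the loss incurred
    when two Gromov products at level [j] are composed; the resulting constant
    depends only on [h]. *)
Section levels.
Variable h : R.
Hypothesis h_ge1 : 1 <= h.
Let c (j : nat) : R := expR (2 * h * j.+1%:R).

Let c_ge0 j : 0 <= c j. Proof. exact: expR_ge0. Qed.

Lemma exp_le_levels (s : R) (J : nat) : 0 <= s -> s < J%:R * h ->
  expR (2 * s) <= \sum_(j < J) c j * (j%:R * h <= s)%R%:R.
Proof.
move=> s0; elim: J => [|J IH]; first by rewrite mul0r ltNge s0.
rewrite big_ord_recr /= => sJ; have [sJ'|sJ'] := ltP s (J%:R * h).
  by rewrite mulr0 addr0; exact: IH.
rewrite mulr1 -[leLHS]add0r; apply: lerD.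
  by apply: sumr_ge0 => j _; rewrite mulr_ge0.
by rewrite ler_expR /c; lra.
Qed.

Lemma sum_levels_le (s : R) (J : nat) : 0 <= s ->
  \sum_(j < J) c j * (j.-1%:R * h <= s)%R%:R <= 2 * expR (4 * h) * expR (2 * s).
Proof.
move=> s0.
have geom n : \sum_(j < n) c j <= 2 * expR (2 * h * n%:R).
  elim: n => [|n IH]; first by rewrite big_ord0 mulr_ge0 ?expR_ge0.
  rewrite big_ord_recr /=.
  have : 2 * expR (2 * h * n%:R) <= c n.
    rewrite /c -(natr1 n) mulrDr mulr1 expRD mulrC ler_wpM2l ?expR_ge0//.
    by apply: le_trans (expR_ge1Dx _); move: h_ge1; lra.
  by move: IH; rewrite /c; lra.
have nonneg : 0 <= 2 * expR (4 * h) * expR (2 * s) by rewrite !mulr_ge0 ?expR_ge0.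
elim: J => [|J IH]; first by rewrite big_ord0.
have [sJ|sJ] := boolP (J.-1%:R * h <= s); last first.
  by rewrite big_ord_recr /= (negbTE sJ) mulr0 addr0.
apply: le_trans (_ : \sum_(j < J.+1) c j <= _).
  by apply: ler_sum => j _; rewrite ler_piMr// lern1 leq_b1.
apply: le_trans (geom _) _; rewrite -[leRHS]mulrA ler_wpM2l// -expRD ler_expR.
case: J sJ {IH} => [|J] /=; first by move=> _; move: h_ge1; lra.
move=> sJ; rewrite -(natr1 J.+1) -(natr1 J). move: h_ge1 sJ; nra.
Qed.

End levels.

(** Since [- d(x, y) = - d(o, x) - d(o, y) + 2 (x, y)_o], this is [decay] times
    [exp (d(o, x)) * exp (d(o, y))], a factor that can be moved into the weights. *)
Definition gp_kernel (o x y : X) : R := expR (2 * gp o x y).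

Variable delta : R.
Hypotheses (delta_ge0 : 0 <= delta) (hyp : hyperbolic_constant X delta).

(** Hyperbolicity says that the relations [j * h <= (x, y)_o], for [h >= delta], become
    transitive after the loss of one level: [pairing_rel_le] applies to each level,
    and the geometric sums absorb the shift. *)
Lemma pairing_gp_le (o : X) l m : nonneg_weights l -> nonneg_weights m ->
  pairing (gp_kernel o) l m <=
  cs_constant delta * (pairing (gp_kernel o) l l + pairing (gp_kernel o) m m).
Proof.
move=> l0 m0; set h := delta + 1.
have h1 : 1 <= h by rewrite /h; move: delta_ge0; lra.
pose r (j : nat) x y := (j%:R * h <= gp o x y)%R.
have rC j x y : r j x y = r j y x by rewrite /r gpC.
have r_trans j x y z : r j x y -> r j y z -> r j.-1 x z.
  move=> rxy ryz; rewrite /r; case: j rxy ryz => [_ _|j rxy ryz] /=.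
    by rewrite mul0r gp_ge0.
  by have := gp_trans _ hyp _ _ _ _ _ rxy ryz; rewrite -(natr1 j) /h; lra.
(* beyond level J no pair of points of the two supports is related *)
pose J := (Num.truncn (\sum_(p <- l) mdist o p.2)).+1.
have gpJ p q : p \in l -> q \in m -> gp o p.2 q.2 < J%:R * h.
  move=> pl _; apply: le_lt_trans (gp_le_dist _ _ _) _.
  apply: le_lt_trans (_ : mdist o p.2 <= \sum_(p <- l) mdist o p.2) _.
    rewrite (big_rem p)//= lerDl sumr_ge0// => i _; exact: mdist_ge0.
  have : \sum_(p <- l) mdist o p.2 < J%:R by rewrite /J; exact: truncnS_gt.
  have : (0 : R) <= J%:R by [].
  by nra.
pose c (j : nat) : R := expR (2 * h * j.+1%:R).
apply: le_trans (_ : \sum_(j < J) c j * pairing (fun x y => (r j x y)%:R) l m <= _).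
  under eq_bigr do rewrite -pairingZ.
  rewrite -(pairing_sum 'I_J (fun j x y => c j * (r j x y)%:R)); apply: ler_pairing => // p q pl qm.
  by apply: exp_le_levels => //; [exact: gp_ge0|exact: gpJ].
apply: le_trans (_ : \sum_(j < J) c j * (pairing (fun x y => (r j.-1 x y)%:R) l l +
   pairing (fun x y => (r j.-1 x y)%:R) m m) <= _).
  apply: ler_sum => j _; rewrite ler_wpM2l ?expR_ge0//.
  by apply: pairing_rel_le => // x y z; exact: r_trans.
under eq_bigr do rewrite mulrDr -!pairingZ.
rewrite big_split /= -!(pairing_sum 'I_J (fun j x y => c j * (r j.-1 x y)%:R)).
rewrite mulrDr -!pairingZ; apply: lerD;
  by apply: ler_pairing => // p q _ _; apply: sum_levels_le => //; exact: gp_ge0.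
Qed.

(** Cauchy-Schwarz up to a constant for positive measures, in the form of Young's
    inequality. The kernel [exp (- d)] need not be positive definite on a hyperbolic
    space, hence the constant; it depends on nothing but [delta]. *)
Lemma pairing_decay_le l m (t : R) : 0 < t -> nonneg_weights l -> nonneg_weights m ->
  pairing decay l m <= cs_constant delta * (t * energy l + t^-1 * energy m).
Proof.
move=> t0 l0 m0; case: l l0 => [|p l] l0.
  rewrite /energy /pairing !big_nil mulr0 add0r.
  rewrite mulr_ge0 ?(ltW (cs_constant_gt0 _))// mulr_ge0 ?invr_ge0 ?(ltW t0)//.
  exact: energy_ge0.
(* any basepoint does; a point of the support is at hand *)
pose o := p.2; set l' := p :: l.
pose w x := expR (- mdist o x); pose k := gp_kernel o.
have w0 x : 0 <= w x by exact: expR_ge0.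
have kw x y : decay x y = w x * w y * k x y.
  by rewrite /decay /w /k /gp_kernel -!expRD gpE; congr expR; lra.
have pairingw a b u v : pairing k (reweight (fun x => a * w x) u) (reweight (fun x => b * w x) v) =
    a * b * pairing decay u v.
  rewrite pairing_reweight -pairingZ; congr pairing; apply/funext => x.
  by apply/funext => y; rewrite kw; lra.
have nn a u : 0 <= a -> nonneg_weights u -> nonneg_weights (reweight (fun x => a * w x) u).
  by move=> a0 u0; apply: nonneg_reweight => // x; rewrite mulr_ge0.
have := pairing_gp_le o _ _ (nn t _ (ltW t0) l0) (nn 1 _ ler01 m0).
rewrite -/k !pairingw !mulr1 mul1r -/(energy _) -/(energy m) => le.
rewrite -(ler_pM2l t0); apply: le_trans le _.
rewrite le_eqVlt; apply/orP; left; apply/eqP.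
rewrite [RHS]mulrCA; congr (_ * _).
by rewrite mulrDr !mulrA mulfV ?gt_eqF// mul1r.
Qed.

End CauchySchwarz.

(** * Schottky families contract the energy *)

Section IsomAction.
Context {R : realType} {X : metricType R}.
Implicit Types f g : Isom X.

Lemma isomM f g x : (f * g)%g x = f (g x). Proof. by []. Qed.

Lemma isom1 (x : X) : (1%g : Isom X) x = x. Proof. by []. Qed.

Lemma isomVK f x : f ((f^-1)%g x) = x.
Proof. by rewrite -isomM mulgV. Qed.

Definition translate f (l : seq (R * X)) : seq (R * X) := [seq (p.1, f p.2) | p <- l].

Lemma pairing_translate f g k l m : pairing k (translate f l) (translate g m) =
  pairing (fun x y => k (f x) (g y)) l m.
Proof.
by rewrite /pairing big_map; apply: eq_bigr => p _; rewrite big_map.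
Qed.

Lemma nonneg_translate f l : nonneg_weights (translate f l) = nonneg_weights l.
Proof. by rewrite /nonneg_weights all_map. Qed.

Lemma energy_translate f l : energy (translate f l) = energy l.
Proof.
rewrite /energy pairing_translate; congr pairing; apply/funext => x; apply/funext => y.
by rewrite /decay isom_dist.
Qed.

Definition restrict (a : pred X) (l : seq (R * X)) : seq (R * X) := [seq p <- l | a p.2].

Lemma nonneg_restrict a l : nonneg_weights l -> nonneg_weights (restrict a l).
Proof.
by move=> /allP l0; apply/allP => p; rewrite mem_filter => /andP[_ /l0].
Qed.

Lemma pairing_restrict a b k l m : pairing k (restrict a l) (restrict b m) =
  pairing (fun x y => (a x && b y)%:R * k x y) l m.
Proof.
rewrite /pairing /restrict big_filter big_mkcond; apply: eq_bigr => p _ /=.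
rewrite big_filter; case: (a p.2); rewrite /= ?big_mkcond.
  by apply: eq_bigr => q _; case: (b q.2); rewrite ?mul1r ?mul0r ?mulr0.
by rewrite big1// => q _; rewrite mul0r mulr0.
Qed.

End IsomAction.

Section Schottky.
Context {R : realType} {X : metricType R}.
Local Notation gp := gromov_product.
Variables (delta : R) (o : X).
Hypotheses (delta_ge0 : 0 <= delta) (hyp : hyperbolic_constant X delta).

(** The broken line [f x, f o, o, g o, g y] has small Gromov products at its three inner
    vertices and long middle segments, so its length is nearly realised by its ends:
    moving [x] by [f] and [y] by [g] pulls them apart by nearly [2 L]. *)
Lemma pingpong_dist (f g : Isom X) (x y : X) (C B L : R) :
  gp o (f o) (g o) <= C -> gp o ((f^-1)%g o) x <= B -> gp o ((g^-1)%g o) y <= B ->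
  L <= mdist o (f o) -> L <= mdist o (g o) -> C + B + 2 * delta < L ->
  mdist x y + 2 * (L - 2 * B - C - 2 * delta) <= mdist (f x) (g y).
Proof.
move=> fgC fxB gyB fL gL CBL.
have back (h : Isom X) z : gp (h o) o (h z) = gp o ((h^-1)%g o) z.
  by rewrite -[RHS](gp_isom h) isomVK.
have far (h : Isom X) z : gp o ((h^-1)%g o) z <= B -> L <= mdist o (h o) ->
    L - B <= gp o (h o) (h z).
  by move=> zB hL; have := gp_add o (h o) (h z); rewrite back; move: zB hL; lra.
have fxyC : gp o (f x) (g y) <= C + 2 * delta.
  rewrite leNgt; apply/negP => lt; pose t := Num.min (gp o (f x) (g y)) (L - B).
  have tlt : C + 2 * delta < t by rewrite lt_min lt /=; move: CBL; lra.
  have t1 : t <= gp o (f o) (f x) by rewrite ge_min far ?orbT.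
  have t2 : t <= gp o (f x) (g y) by rewrite ge_min lexx.
  have t3 : t <= gp o (g y) (g o) by rewrite gpC ge_min far ?orbT.
  have t4 := gp_trans _ hyp _ _ _ _ _ t1 t2.
  have t5 : t - delta <= gp o (g y) (g o) by move: t3 delta_ge0; lra.
  have := gp_trans _ hyp _ _ _ _ _ t4 t5; move: tlt fgC; lra.
move: fxyC fxB gyB; rewrite -!back !gpE !isom_dist !(metric_sym (_ o) o).
by have := metric_triangle x o y; rewrite (metric_sym x o); move: fL gL; lra.
Qed.

Variables (N : nat) (s : 'I_N -> Isom X) (C L : R).
Hypotheses
  (s_fwd : forall i j, i != j -> gp o (s i o) (s j o) <= C)
  (s_bwd : forall i j, i != j -> gp o (((s i)^-1)%g o) (((s j)^-1)%g o) <= C)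
  (s_long : forall i, L <= mdist o (s i o))
  (CL : 2 * C + 3 * delta < L).

(* the points that s i may bring closer to o: those seen from o in the direction of
   s_i^-1 o; by s_bwd these regions are disjoint *)
Let bad i x := C + delta < gp o (((s i)^-1)%g o) x.

Let bad_uniq i j x : bad i x -> bad j x -> i = j.
Proof.
move=> bi bj; apply/eqP/negPn/negP => ij; have := s_bwd _ _ ij; apply/negP.
rewrite -ltNge; pose t := Num.min (gp o (((s i)^-1)%g o) x) (gp o (((s j)^-1)%g o) x).
have : C + delta < t by rewrite lt_min; apply/andP.
have t1 : t <= gp o (((s i)^-1)%g o) x by rewrite ge_min lexx.
have t2 : t <= gp o x (((s j)^-1)%g o) by rewrite gpC ge_min lexx orbT.
by have := gp_trans _ hyp _ _ _ _ _ t1 t2; lra.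
Qed.

Let sum_energy_bad l : nonneg_weights l ->
  \sum_i energy (restrict (bad i) l) <= energy l.
Proof.
move=> l0; under eq_bigr do rewrite /energy pairing_restrict.
rewrite -(pairing_sum 'I_N (fun i x y => (bad i x && bad i y)%:R * decay x y)).
apply: ler_pairing => // p q _ _; rewrite -mulr_suml ler_piMl ?decay_ge0//.
case: (pickP (fun i => bad i p.2)) => [i bi|nobad]; last first.
  by rewrite big1// => i _; rewrite nobad.
rewrite (bigD1 i)//= big1 ?addr0 ?lern1 ?leq_b1// => j ji.
by case: (boolP (bad j p.2)) => //= /bad_uniq /(_ bi) ij; rewrite ij eqxx in ji.
Qed.

(** The energy of the sum of the [N] translates of [l] would be [N ^ 2 * energy l] if these
    were all equal. The [N] diagonal terms only contribute [N * energy l]; a pair of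
    distinct indices has its kernel multiplied by [exp (- 2 L + ...)], except on the bad
    regions. These are handled by Cauchy-Schwarz, and being disjoint they carry together at
    most the energy of [l]: with [t] of order [sqrt N] their contribution is of order
    [N ^ (3 / 2) * energy l]. *)
Lemma schottky_energy l (t : R) : 0 < t -> nonneg_weights l ->
  \sum_i \sum_j pairing decay (translate (s i) l) (translate (s j) l) <=
  (N%:R + N%:R ^+ 2 * expR (- (2 * (L - 3 * C - 4 * delta)))
   + 2 * cs_constant delta * (N%:R * t + N%:R ^+ 2 / t)) * energy l.
Proof.
move=> t0 l0; set G := 2 * (L - _ - _); set c0 := cs_constant delta; set I := energy l.
have I0 : 0 <= I by exact: energy_ge0.
have c00 : 0 < c0 by exact: cs_constant_gt0.
pose e i := energy (restrict (bad i) l).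
have e0 i : 0 <= e i by apply: energy_ge0; exact: nonneg_restrict.
have term i j : pairing decay (translate (s i) l) (translate (s j) l) <=
    (i == j)%:R * I + (expR (- G) * I + (c0 * (t * e i + t^-1 * I) + c0 * (t * e j + t^-1 * I))).
  have [<-|ij] := eqVneq i j.
    rewrite mul1r -/(energy _) energy_translate lerDl addr_ge0 ?mulr_ge0 ?expR_ge0//.
    by rewrite addr_ge0// mulr_ge0 ?(ltW c00)// addr_ge0// mulr_ge0 ?invr_ge0 ?(ltW t0).
  rewrite mul0r add0r pairing_translate.
  pose k x y := decay (s i x) (s j y).
  apply: le_trans (_ : pairing (fun x y => expR (- G) * decay x y +
     ((bad i x && true)%:R * k x y + (true && bad j y)%:R * k x y)) l l <= _).
    apply: ler_pairing => // p q _ _; rewrite andbT /=.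
    have k0 : 0 <= k p.2 q.2 by exact: decay_ge0.
    have d0 : 0 <= expR (- G) * decay p.2 q.2 by rewrite mulr_ge0 ?expR_ge0.
    have [bi|bi] := boolP (bad i p.2).
      rewrite mul1r; case: (bad j q.2); rewrite ?mul1r ?mul0r -/(k _ _); lra.
    have [bj|bj] := boolP (bad j q.2); first by rewrite mul1r mul0r -/(k _ _); lra.
    rewrite !mul0r !addr0 /decay -expRD ler_expR.
    move: bi bj; rewrite /bad -!leNgt => bi bj.
    have := pingpong_dist (s i) (s j) p.2 q.2 C (C + delta) L (s_fwd _ _ ij) bi bj
      (s_long i) (s_long j); rewrite /G; move: CL; lra.
  have split3 (k1 k2 k3 : X -> X -> R) : pairing (fun x y => k1 x y + (k2 x y + k3 x y)) l l =
      pairing k1 l l + (pairing k2 l l + pairing k3 l l).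
    rewrite /pairing -!big_split; apply: eq_bigr => p _ /=; rewrite -!big_split.
    by apply: eq_bigr => q _ /=; rewrite !mulrDr.
  rewrite split3 pairingZ lerD2l -!pairing_restrict.
  have all_true : restrict xpredT l = l by rewrite /restrict filter_predT.
  rewrite all_true; apply: lerD.
    rewrite -(pairing_translate (s i) (s j)).
    apply: le_trans (pairing_decay_le _ delta_ge0 hyp _ _ _ t0 _ _) _;
      by rewrite ?nonneg_translate ?nonneg_restrict// !energy_translate.
  rewrite -(pairing_translate (s i) (s j)) pairing_flip.
  have -> : (fun x y : X => decay y x) = decay.
    by apply/funext => x; apply/funext => y; rewrite decayC.
  apply: le_trans (pairing_decay_le _ delta_ge0 hyp _ _ _ t0 _ _) _;
    by rewrite ?nonneg_translate ?nonneg_restrict// !energy_translate.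
apply: le_trans (ler_sum _ (fun i _ => ler_sum _ (fun j _ => term i j))) _.
pose F i := c0 * (t * e i + t^-1 * I).
have const (a : R) : \sum_(i < N) a = N%:R * a by rewrite sumr_const card_ord mulr_natl.
have inner i : \sum_j ((i == j)%:R * I + (expR (- G) * I + (F i + F j))) =
    I + (N%:R * (expR (- G) * I) + (N%:R * F i + \sum_j F j)).
  rewrite !big_split /= !const; congr (_ + _).
  rewrite (bigD1 i)//= eqxx mul1r big1 ?addr0// => j.
  by rewrite eq_sym => /negbTE ->; rewrite mul0r.
under eq_bigr do rewrite inner.
rewrite !big_split /= !const -mulr_sumr.
have -> : \sum_i F i = c0 * (t * \sum_i e i + N%:R * (t^-1 * I)).
  by rewrite -mulr_sumr big_split /= -mulr_sumr const.
have := sum_energy_bad l l0; rewrite -/I => S.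
have tc : 0 <= c0 * N%:R * t by rewrite !mulr_ge0 ?(ltW c00) ?(ltW t0).
have := ler_wpM2l tc S.
rewrite /e; set E := \sum_i _; set u := t^-1.
nra.
Qed.

End Schottky.

(** * Orbits of loxodromic isometries *)

(** Here [a n] stands for [d(o, f^n o)]; the last two hypotheses are the four-point
    inequality for the points [o, f^m o, f^(m+n) o, f^(m+n+p) o] of an orbit. *)
Section QuasiAdditive.
Context {R : realType}.
Variables (a : nat -> R) (delta : R).
Hypotheses (a_sub : forall m n, a (m + n)%N <= a m + a n)
  (a_rev : forall m n, a m <= a (m + n)%N + a n)
  (a_four1 : forall m n p, a (m + n)%N + a (n + p)%N <=
     Num.max (a m + a p) (a n + a (m + n + p)%N) + 2 * delta)
  (a_four2 : forall m n p, a n + a (m + n + p)%N <=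
     Num.max (a m + a p) (a (m + n)%N + a (n + p)%N) + 2 * delta).

Let a_ge0 n : 0 <= a n.
Proof. by have := a_rev 0 n; have := a_rev n 0; have := a_sub 0 n; rewrite addn0 add0n; lra. Qed.

Let a_linear n : (0 < n)%N -> a n <= n%:R * a 1.
Proof.
elim: n => // -[|n] IH _; first by rewrite mul1r.
have := a_sub n.+1 1; rewrite addn1 -(natr1 n.+1) mulrDl mul1r.
by have := IH isT; lra.
Qed.

(** An orbit of linear growth has no backtracking. For a suitable fixed [r], adding [r] to
    [m] always increases [a m] by more than [delta] once [a m] is large: otherwise the
    four-point inequality bounds each later term by a term [r] or [m + r] steps before
    plus [3 delta], and the growth rate is at most [3 delta / r]. With this, the
    four-point inequality for [m, r, p] can only hold through its second alternative,
    which is the claim. *)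
Lemma quasi_additive (c C : R) : 0 < c -> 0 <= delta ->
  (forall n, c * n%:R - C <= a n) ->
  exists D : R, forall m n, a m + a n <= a (m + n)%N + D.
Proof.
move=> c0 delta0 grow.
pose r := (Num.truncn (3 * delta / c)).+1.
have rc : 3 * delta < c * r%:R.
  by rewrite (mulrC c) -ltr_pdivrMr//; exact: truncnS_gt.
have step m : a r <= a m -> a m + delta < a (m + r)%N.
  move=> rm; rewrite ltNge; apply/negP => stall.
  have jump y : a (y + (m + r))%N <= Num.max (a y) (a (y + m)%N) + 3 * delta.
    have := a_four2 r m y.
    rewrite (addnC r m) (addnC m y) (addnC (m + r) y).
    rewrite !maxEle; case: ifP => _; case: ifP => h; move: h stall rm; lra.
  pose A := (m + r)%:R * a 1 + a 0.
  have bound n : a n * r%:R <= A * r%:R + 3 * delta * n%:R.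
    have r0 : (0 : R) < r%:R by [].
    elim: n {-2}n (leqnn n) => [|k IH] n.
      rewrite leqn0 => /eqP ->; rewrite mulr0 addr0 ler_wpM2r// /A lerDr.
      by rewrite mulr_ge0.
    move=> nk; have [lt|ge] := ltnP n (m + r).
      apply: le_trans (_ : A * r%:R <= _); last by rewrite lerDl !mulr_ge0.
      rewrite ler_wpM2r// /A; case: n lt {nk} => [|n] lt; first by rewrite lerDr mulr_ge0.
      apply: le_trans (a_linear n.+1 isT) _; rewrite -[leLHS]addr0 lerD//.
      by rewrite ler_wpM2r// ler_nat ltnW.
    have [y ny] : exists y, n = (y + (m + r))%N by exists (n - (m + r))%N; rewrite subnK.
    have := jump y; rewrite -ny => jy.
    have rpos : (0 < r)%N by [].
    have y1 := IH y ltac:(lia); have y2 := IH (y + m)%N ltac:(lia).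
    have nE : (n%:R : R) = y%:R + m%:R + r%:R by rewrite ny !natrD addrA.
    have m0 : (0 : R) <= m%:R by [].
    move: y1 y2; rewrite natrD nE; move: jy; rewrite maxEle; case: ifP => _; nra.
  pose n := (Num.truncn ((A + C) * r%:R / (c * r%:R - 3 * delta))).+1.
  have : (A + C) * r%:R < n%:R * (c * r%:R - 3 * delta).
    by rewrite -ltr_pdivrMr ?subr_gt0//; exact: truncnS_gt.
  have r0 : (0 : R) < r%:R by [].
  have := bound n; have := grow n; nra.
exists (2 * a r) => m p.
have [rm|rm] := leP (a r) (a m); last first.
  have := a_rev p m; rewrite addnC; move: rm; lra.
have [rp|rp] := leP (a r) (a p); last first.
  by have := a_rev m p; move: rp; lra.
have := a_four1 m r p; have := step m rm; have := step p rp.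
have := a_sub (m + p) r; rewrite (addnAC m r p) (addnC r p).
by rewrite maxEle; case: ifP => _; lra.
Qed.

End QuasiAdditive.

Section Loxodromic.
Context {R : realType} {X : metricType R}.
Local Notation gp := gromov_product.
Variables (delta : R) (o : X).
Hypotheses (delta_ge0 : 0 <= delta) (hyp : hyperbolic_constant X delta).
Implicit Types (f g u v : Isom X).

Lemma four_point (x y z w : X) : mdist x z + mdist y w <=
  Num.max (mdist x y + mdist z w) (mdist x w + mdist y z) + 2 * delta.
Proof.
have := hyp y z w x; rewrite !gpE minEle maxEle.
by case: ifP => [|/negbT]; case: ifP => [|/negbT]; rewrite -?ltNge; lra.
Qed.

Lemma dist_expg f (m n : nat) : mdist ((f ^+ m)%g o) ((f ^+ (m + n))%g o) =
  mdist o ((f ^+ n)%g o).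
Proof. by rewrite expgnDr isomM isom_dist. Qed.

Lemma dist_isomV f : mdist o ((f^-1)%g o) = mdist o (f o).
Proof. by rewrite -(isom_dist f) isomVK metric_sym. Qed.

Definition escaping f : Prop :=
  exists2 c : R, 0 < c & exists C : R, forall n : nat, c * n%:R - C <= mdist o ((f ^+ n)%g o).

Lemma escapingV f : escaping f -> escaping (f^-1)%g.
Proof.
by move=> [c c0 [C fC]]; exists c => //; exists C => n; rewrite expVgn dist_isomV.
Qed.

Lemma loxodromic_escaping f : loxodromic o f -> escaping f.
Proof.
move=> [L [C [L1 C0 LC]]]; exists L^-1; first by rewrite invr_gt0; lra.
exists C => n; have /andP[+ _] := LC (Posz 0) (Posz n).
rewrite (_ : expgz f (Posz 0) o = o) // (_ : expgz f (Posz n) = f ^+ n)%g // mulrC.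
by rewrite sub0r normrN.
Qed.

Lemma escaping_far f (A : R) : escaping f ->
  exists M, forall n, (M <= n)%N -> A <= mdist o ((f ^+ n)%g o).
Proof.
move=> [c c0 [C fC]]; exists (Num.truncn ((A + C) / c)).+1 => n Mn.
apply: le_trans (fC n); rewrite lerBrDr (mulrC c) -ler_pdivrMr//.
by apply: le_trans (ltW (truncnS_gt _)) _; rewrite ler_nat.
Qed.

Lemma dist_expg_le f (n : nat) : mdist o ((f ^+ n)%g o) <= n%:R * mdist o (f o).
Proof.
elim: n => [|n IH]; first by rewrite expg0 isom1 mdistxx mul0r.
rewrite -(natr1 n) mulrDl mul1r -addn1; apply: le_trans (metric_triangle _ ((f ^+ n)%g o) _) _.
by rewrite dist_expg lerD.
Qed.

Lemma escaping_quasi_additive f : escaping f -> exists D : R, forall m n,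
  mdist o ((f ^+ m)%g o) + mdist o ((f ^+ n)%g o) <= mdist o ((f ^+ (m + n))%g o) + D.
Proof.
move=> [c c0 [C fC]]; pose pt n := (f ^+ n)%g o.
have ptD m n : mdist (pt m) (pt (m + n)%N) = mdist o (pt n) by exact: dist_expg.
have pt0 : pt 0 = o by rewrite /pt expg0.
apply: (@quasi_additive _ (fun n => mdist o (pt n)) delta _ _ _ _ c C) => //.
- by move=> m n; rewrite -(ptD m n); exact: metric_triangle.
- move=> m n; rewrite -(ptD m n) (metric_sym (pt m)); exact: metric_triangle.
- move=> m n p; have := four_point o (pt m) (pt (m + n)%N) (pt (m + n + p)%N).
  by rewrite !ptD -addnA ptD addnA [X in Num.max _ X]addrC.
- move=> m n p; have := four_point (pt m) o (pt (m + n)%N) (pt (m + n + p)%N).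
  by rewrite !ptD -addnA ptD addnA (metric_sym (pt m) o) [X in Num.max _ X]addrC.
Qed.

(** Powers of [f] far along the orbit are close as seen from [o]: the orbit is a Gromov
    sequence. *)
Lemma escaping_gp f (A : R) : escaping f -> exists M, forall m n,
  (M <= m)%N -> (M <= n)%N -> A <= gp o ((f ^+ m)%g o) ((f ^+ n)%g o).
Proof.
move=> ef; have [D fD] := escaping_quasi_additive f ef.
have [M fM] := escaping_far f (A + D / 2) ef; exists M.
have half m n : (m <= n)%N -> (M <= m)%N -> A <= gp o ((f ^+ m)%g o) ((f ^+ n)%g o).
  move=> /subnKC <- Mm; rewrite gpE dist_expg.
  have := fD m (n - m)%N; have := fM m Mm; lra.
move=> m n Mm Mn; have [mn|/ltnW nm] := leqP m n; first exact: half.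
by rewrite gpC; exact: half.
Qed.

Lemma gromov_asymptoticP (x y : nat -> X) : gromov_asymptotic o x y <->
  (forall A : R, exists M, forall m n, (M <= m)%N -> (M <= n)%N -> A <= gp o (x m) (y n)).
Proof.
rewrite /gromov_asymptotic; split=> [/cvgryPge xy A|xy].
  have [[P Q] /= [[m _ mP] [n _ nQ]] PQ] := xy A.
  exists (maxn m n) => i j; rewrite !geq_max => /andP[mi _] /andP[_ nj].
  by apply: (PQ (i, j)); split => /=; [exact: mP|exact: nQ].
apply/cvgryPge => A; have [M xyM] := xy A.
exists ([set n | (M <= n)%N], [set n | (M <= n)%N]); first by split; exists M.
by move=> [m n] /= [Mm Mn]; exact: xyM.
Qed.

Lemma gromov_asymptotic_sym (x y : nat -> X) :
  gromov_asymptotic o x y -> gromov_asymptotic o y x.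
Proof.
move=> /gromov_asymptoticP xy; apply/gromov_asymptoticP => A.
by have [M xyM] := xy A; exists M => m n Mm Mn; rewrite gpC; exact: xyM.
Qed.

Lemma gromov_asymptotic_trans (x y z : nat -> X) :
  gromov_asymptotic o x y -> gromov_asymptotic o y z -> gromov_asymptotic o x z.
Proof.
move=> /gromov_asymptoticP xy /gromov_asymptoticP yz; apply/gromov_asymptoticP => A.
have [M xyM] := xy (A + delta); have [M' yzM] := yz (A + delta).
exists (maxn M M') => m n; rewrite !geq_max => /andP[Mm _] /andP[_ Mn].
rewrite -[A](addrK delta); apply: (gp_trans _ hyp _ _ _ (y (maxn M M'))).
  by apply: xyM => //; exact: leq_maxl.
by apply: yzM => //; exact: leq_maxr.
Qed.

(** An isometry changes Gromov products based at [o] by a bounded amount only. *)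
Lemma gromov_asymptotic_isom g (x y z : nat -> X) (B : R) :
  (forall n, mdist (g (x n)) (z n) <= B) ->
  gromov_asymptotic o x y -> gromov_asymptotic o z (g \o y).
Proof.
move=> gxz /gromov_asymptoticP xy; apply/gromov_asymptoticP => A.
have [M xyM] := xy (A + B + mdist (g o) o); exists M => m n Mm Mn /=.
have := xyM m n Mm Mn; rewrite -(gp_isom g).
have := gp_base (g o) o (g (x m)) (g (y n)); have := gp_move o (g (x m)) (z m) (g (y n)).
have := gxz m; lra.
Qed.

Definition orbit_end f : set (nat -> X) := gromov_class o (fun n => (f ^+ n)%g o).

(** Stated for [u] commuting with [f] in order to cover [f = u] and [f = u^-1] at once,
    the attracting and the repelling point of [u]. *)
Lemma orbit_end_fixed f u : escaping f -> commute u f ->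
  fixed_at_infinity o u (orbit_end f).
Proof.
move=> ef uf; have fG : gromov_sequence o (fun n => (f ^+ n)%g o).
  by apply/gromov_asymptoticP => A; exact: escaping_gp.
split; first by exists (fun n => (f ^+ n)%g o).
have stable g : commute g f -> forall w, orbit_end f w -> orbit_end f (g \o w).
  move=> gf w [wG fw]; split.
    apply: (gromov_asymptotic_isom g w w (g \o w) 0) => // n.
    by rewrite mdistxx.
  apply: (gromov_asymptotic_isom g _ _ _ (mdist (g o) o) _ fw) => n.
  by rewrite -isomM (commuteX n gf) isomM isom_dist.
apply/seteqP; split => [_ [w fw <-]|w fw]; first exact: stable.
exists ((u^-1)%g \o w); last by apply/funext => n /=; rewrite isomVK.
by apply: stable => //; apply/commute_sym/commuteV/commute_sym.
Qed.

(** If [(f^k o, g^j o)_o] is large for some [k] and [j], then these are both large, and the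
    tails of the two orbits, each of which stays together, are close to one another. An
    unbounded Gromov product thus makes the two orbits asymptotic. *)
Lemma orbit_ends_gp_bounded f g : escaping f -> escaping g ->
  orbit_end f <> orbit_end g ->
  exists C : R, forall m n, gp o ((f ^+ m)%g o) ((g ^+ n)%g o) <= C.
Proof.
move=> ef eg fg; apply: contrapT => unbounded; apply: fg.
have large (A : R) : exists m n, A < gp o ((f ^+ m)%g o) ((g ^+ n)%g o).
  apply: contrapT => nA; apply: unbounded; exists A => m n.
  by rewrite leNgt; apply/negP => lt; apply: nA; exists m, n.
have asym : gromov_asymptotic o (fun n => (f ^+ n)%g o) (fun n => (g ^+ n)%g o).
  apply/gromov_asymptoticP => A.
  have [M fM] := escaping_gp f (A + 2 * delta) ef.
  have [M' gM] := escaping_gp g (A + 2 * delta) eg.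
  exists (maxn M M') => m n; rewrite !geq_max => /andP[Mm _] /andP[_ Mn].
  pose df := mdist o (f o); pose dg := mdist o (g o).
  have df0 : 0 <= df by exact: mdist_ge0.
  have dg0 : 0 <= dg by exact: mdist_ge0.
  have Mdf : 0 <= M%:R * df by rewrite mulr_ge0.
  have Mdg : 0 <= M'%:R * dg by rewrite mulr_ge0.
  (* The last two terms force k >= M and j >= M', as d(o, f^k o) <= k d(o, f o). *)
  have [k [j kj]] := large (`|A| + 2 * delta + M%:R * df + M'%:R * dg).
  have Aabs := ler_norm A; have A0 := normr_ge0 A.
  have Mk : (M <= k)%N.
    rewrite leqNgt; apply/negP => kM.
    have := le_trans (gp_le_dist o _ ((g ^+ j)%g o)) (dist_expg_le f k).
    have : k%:R * df <= M%:R * df by rewrite ler_wpM2r// ler_nat ltnW.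
    by move: kj delta_ge0; rewrite -/df; lra.
  have Mj : (M' <= j)%N.
    rewrite leqNgt; apply/negP => jM.
    have := le_trans (gp_le_dist o _ ((f ^+ k)%g o)) (dist_expg_le g j).
    have : j%:R * dg <= M'%:R * dg by rewrite ler_wpM2r// ler_nat ltnW.
    by move: kj delta_ge0; rewrite gpC -/dg; lra.
  have kj' : A + 2 * delta <= gp o ((f ^+ k)%g o) ((g ^+ j)%g o).
    by move: kj; lra.
  have h1 := gp_trans _ hyp _ _ _ _ _ (fM m k Mm Mk) kj'.
  have h2 : A + 2 * delta - delta <= gp o ((g ^+ j)%g o) ((g ^+ n)%g o).
    by have := gM j n Mj Mn; move: delta_ge0; lra.
  by have := gp_trans _ hyp _ _ _ _ _ h1 h2; lra.
apply/seteqP; split => w [wG fw]; split => //.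
  exact: gromov_asymptotic_trans (gromov_asymptotic_sym _ _ asym) fw.
exact: gromov_asymptotic_trans asym fw.
Qed.

End Loxodromic.

(** * Construction of Schottky families *)

Section SchottkyWords.
Context {R : realType} {X : metricType R}.
Local Notation gp := gromov_product.
Variables (delta : R) (o : X).
Hypotheses (delta_ge0 : 0 <= delta) (hyp : hyperbolic_constant X delta).
Implicit Types (f g h u v : Isom X).

(** The exponents of [u] add up to [N M] whatever [i] is, so that all these elements are
    words of the same length and weight in the letters of [u] and [v]. They
    differ in the number of factors [u] in front and, by [sandwichV], at the end. *)
Definition sandwich {G : groupType} (u v : G) (N M T i : nat) : G :=
  (u ^+ (i * M) * v ^+ T * u ^+ ((N - i) * M))%g.

Lemma sandwichV {G : groupType} (u v : G) (N M T i : nat) : (i <= N)%N ->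
  ((sandwich u v N M T i)^-1 = sandwich u^-1 v^-1 N M T (N - i))%g.
Proof. by move=> iN; rewrite /sandwich !invgM !expVgn mulgA subKn. Qed.

(** [f (h o)] is close to [f o] in direction, since [f^-1 o] and [h o] have a small
    Gromov product, and [f o] is in turn far in direction from [h o]. *)
Lemma gp_displaced f h (C : R) : gp o ((f^-1)%g o) (h o) <= C -> gp o (f o) (h o) <= C ->
  2 * C + delta < mdist o (f o) -> gp o (h o) (f (h o)) <= C + delta.
Proof.
move=> fVC fC far; rewrite leNgt; apply/negP => lt.
have e : gp (f o) o (f (h o)) = gp o ((f^-1)%g o) (h o).
  by rewrite -[RHS](gp_isom f) isomVK.
have sum := gp_add o (f o) (f (h o)); rewrite e in sum.
pose t := Num.min (gp o (h o) (f (h o))) (gp o (f (h o)) (f o)).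
have t1 : t <= gp o (h o) (f (h o)) by rewrite ge_min lexx.
have t2 : t <= gp o (f (h o)) (f o) by rewrite ge_min lexx orbT.
have := gp_trans _ hyp _ _ _ _ _ t1 t2; rewrite gpC.
have : C + delta < t by rewrite lt_min lt /= gpC; move: far fVC sum; lra.
by move: fC; lra.
Qed.

(** Up to an error bounded independently of [T], the two points are [v^T o] and
    [u^((j - i) M) v^T o] seen from [o], to which [gp_displaced] applies. *)
Lemma sandwich_gp_le u v (C : R) (N M T : nat) :
  (forall m n, gp o ((u ^+ m)%g o) ((v ^+ n)%g o) <= C) ->
  (forall m n, gp o ((u^-1 ^+ m)%g o) ((v ^+ n)%g o) <= C) ->
  (forall n, (M <= n)%N -> 2 * C + delta < mdist o ((u ^+ n)%g o)) ->
  forall i j, (i < j <= N)%N ->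
  gp o (sandwich u v N M T i o) (sandwich u v N M T j o) <=
    C + delta + 3 * ((N * M)%:R * mdist o (u o)).
Proof.
move=> uv uVv far i j /andP[ij jN]; set W := (N * M)%:R * _.
have uW n : (n <= N)%N -> mdist o ((u ^+ (n * M))%g o) <= W.
  move=> nN; apply: le_trans (dist_expg_le o u _) _.
  by rewrite ler_wpM2r ?mdist_ge0// ler_nat leq_mul2r nN orbT.
pose h := (v ^+ T)%g; pose f := (u ^+ ((j - i) * M))%g.
have core : gp o (h o) (f (h o)) <= C + delta.
  apply: gp_displaced; first by rewrite /f -expVgn; exact: uVv.
    exact: uv.
  by apply: far; rewrite leq_pmull// subn_gt0.
have end_ k : (k <= N)%N -> mdist (sandwich u v N M T k o) ((u ^+ (k * M) * h)%g o) <= W.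
  by move=> kN; rewrite /sandwich isomM isom_dist metric_sym uW// leq_subr.
have := gp_move o (sandwich u v N M T i o) ((u ^+ (i * M) * h)%g o) (sandwich u v N M T j o).
have := gp_move o (sandwich u v N M T j o) ((u ^+ (j * M) * h)%g o) ((u ^+ (i * M) * h)%g o).
rewrite (gpC _ (sandwich u v N M T j o)) (gpC o ((u ^+ (j * M) * h)%g o)).
have := end_ i (ltnW (leq_trans ij jN)); have := end_ j jN.
have := gp_base o ((u ^+ (i * M))%g o) ((u ^+ (i * M) * h)%g o) ((u ^+ (j * M) * h)%g o).
have -> : (u ^+ (j * M) * h)%g o = (u ^+ (i * M))%g (f (h o)).
  by rewrite isomM -(isomM _ f) /f -expgnDr -mulnDl subnKC// ltnW.
rewrite (isomM _ h) gp_isom.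
have := uW i (ltnW (leq_trans ij jN)); move: core; lra.
Qed.

Lemma sandwich_long u v (N M T i : nat) : (i <= N)%N ->
  mdist o ((v ^+ T)%g o) - 2 * ((N * M)%:R * mdist o (u o)) <=
  mdist o (sandwich u v N M T i o).
Proof.
move=> iN; set W := (N * M)%:R * _.
have uW n : (n <= N)%N -> mdist o ((u ^+ (n * M))%g o) <= W.
  move=> nN; apply: le_trans (dist_expg_le o u _) _.
  by rewrite ler_wpM2r ?mdist_ge0// ler_nat leq_mul2r nN orbT.
have := metric_triangle o (sandwich u v N M T i o) ((u ^+ (i * M) * v ^+ T)%g o).
have := metric_triangle ((u ^+ (i * M))%g o) o ((u ^+ (i * M) * v ^+ T)%g o).
rewrite (isomM _ (v ^+ T)%g) isom_dist metric_sym.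
rewrite /sandwich 2!isomM 2!isom_dist (metric_sym ((u ^+ ((N - i) * M))%g o)).
have := uW i iN; have := uW (N - i)%N (leq_subr _ _); lra.
Qed.

Variables u v : Isom X.
Hypotheses (u_esc : escaping o u) (v_esc : escaping o v)
  (uv_ends : fixed_at_infinity o u `&` fixed_at_infinity o v = set0).

(* Each of u, u^-1 has its end fixed by u, and likewise for v: by hypothesis the ends of u
   and v are different, whence a bound in all four cases. *)
Let cross_bounded : exists C : R, forall m n,
  [/\ gp o ((u ^+ m)%g o) ((v ^+ n)%g o) <= C, gp o ((u^-1 ^+ m)%g o) ((v ^+ n)%g o) <= C,
    gp o ((u ^+ m)%g o) ((v^-1 ^+ n)%g o) <= C & gp o ((u^-1 ^+ m)%g o) ((v^-1 ^+ n)%g o) <= C].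
Proof.
have uV_esc := escapingV o u u_esc; have vV_esc := escapingV o v v_esc.
have bounded f g : escaping o f -> escaping o g -> commute u f -> commute v g ->
    exists C : R, forall m n, gp o ((f ^+ m)%g o) ((g ^+ n)%g o) <= C.
  move=> ef eg uf vg; apply: (orbit_ends_gp_bounded delta o delta_ge0 hyp f g ef eg) => fg.
  have fu := orbit_end_fixed delta o delta_ge0 hyp f u ef uf.
  have gv := orbit_end_fixed delta o delta_ge0 hyp g v eg vg.
  by have : set0 (orbit_end o f) by rewrite -uv_ends; split=> //; rewrite fg.
have cV (f : Isom X) : commute f (f^-1)%g by apply: commuteV.
have [C1 h1] := bounded _ _ u_esc v_esc (commute_refl _) (commute_refl _).
have [C2 h2] := bounded _ _ uV_esc v_esc (cV _) (commute_refl _).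
have [C3 h3] := bounded _ _ u_esc vV_esc (commute_refl _) (cV _).
have [C4 h4] := bounded _ _ uV_esc vV_esc (cV _) (cV _).
exists (`|C1| + `|C2| + `|C3| + `|C4|) => m n.
have := normr_ge0 C1; have := normr_ge0 C2; have := normr_ge0 C3; have := normr_ge0 C4.
have := ler_norm C1; have := ler_norm C2; have := ler_norm C3; have := ler_norm C4.
have := h1 m n; have := h2 m n; have := h3 m n; have := h4 m n.
by split; lra.
Qed.

(** The order of the quantifiers matters: the bound [C] on the Gromov products is fixed before
    the length [L], which is then reached by increasing [T] alone. *)
Lemma schottky_sandwiches (N : nat) : exists (M : nat) (C : R), (0 < M)%N /\ forall L : R,
  exists T : nat, let s := fun i : 'I_N => sandwich u v N M T i in
  [/\ forall i j, i != j -> gp o (s i o) (s j o) <= C,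
      forall i j, i != j -> gp o (((s i)^-1)%g o) (((s j)^-1)%g o) <= C &
      forall i, L <= mdist o (s i o)].
Proof.
have [C uvC] := cross_bounded.
have [M' uM'] := escaping_far o u (2 * C + delta + 1) u_esc.
pose M := M'.+1; have uM n : (M <= n)%N -> _ := fun Mn => uM' n (ltnW Mn).
set W := (N * M)%:R * mdist o (u o).
exists M, (C + delta + 3 * W); split=> // L.
have [T vT] := escaping_far o v (L + 2 * W) v_esc; exists T => s.
have far f : (forall n, mdist o ((f ^+ n)%g o) = mdist o ((u ^+ n)%g o)) ->
    forall n, (M <= n)%N -> 2 * C + delta < mdist o ((f ^+ n)%g o).
  by move=> fu n Mn; rewrite fu; have := uM n Mn; lra.
have fwd i j : (i < j <= N)%N -> gp o (sandwich u v N M T i o) (sandwich u v N M T j o) <=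
    C + delta + 3 * W.
  apply: sandwich_gp_le => [m n|m n|]; [by case: (uvC m n)|by case: (uvC m n)|exact: far].
have bwd i j : (i < j <= N)%N -> gp o (sandwich u^-1 v^-1 N M T i o)
    (sandwich u^-1 v^-1 N M T j o) <= C + delta + 3 * W.
  rewrite /W -(dist_isomV o u).
  apply: sandwich_gp_le => [m n|m n|]; [by case: (uvC m n)| |].
    by rewrite invgK; case: (uvC m n).
  by apply: far => n; rewrite expVgn dist_isomV.
have wlog_lt (P : nat -> nat -> Prop) : (forall i j, P i j -> P j i) ->
    (forall i j, (i < j <= N)%N -> P i j) -> forall i j : 'I_N, i != j -> P i j.
  move=> Psym Plt i j; rewrite -val_eqE /= neq_ltn => /orP[ij|ji].
    by apply: Plt; rewrite ij ltnW.
  by apply: Psym; apply: Plt; rewrite ji ltnW.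
split.
- by apply: (wlog_lt (fun i j => _ _ (sandwich u v N M T i o) (sandwich u v N M T j o) <= _))
    => // i j; rewrite gpC.
- apply: (wlog_lt (fun i j => gp o (((sandwich u v N M T i)^-1)%g o)
    (((sandwich u v N M T j)^-1)%g o) <= _)) => [i j|i j /andP[ij jN]]; first by rewrite gpC.
  rewrite !sandwichV ?(ltnW (leq_trans ij jN))// gpC; apply: bwd.
  by rewrite ltn_sub2l ?leq_subr// (leq_trans ij).
- move=> i; have := sandwich_long u v N M T i (ltnW (ltn_ord i)); rewrite -/W.
  by have := vT T (leqnn T); rewrite /s; lra.
Qed.

(** Apply [schottky_energy] with [N = n ^ 2] and [t = n], where [n] is large compared to
    [theta ^ -1], and only then choose [L]. *)
Lemma schottky_contraction (theta : R) : 0 < theta -> exists N M T : nat,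
  let s := fun i : 'I_N => sandwich u v N M T i in
  [/\ (0 < N)%N, (0 < M)%N, injective s & forall l, nonneg_weights l ->
    \sum_i \sum_j pairing decay (translate (s i) l) (translate (s j) l) <=
    theta * N%:R ^+ 2 * energy l].
Proof.
move=> theta0; set c := cs_constant delta.
have c0 : 0 < c by exact: cs_constant_gt0.
pose n := (Num.truncn (2 * (1 + 4 * c) / theta)).+1.
have n_large : (1 + 4 * c) / n%:R < theta / 2.
  rewrite ltr_pdivrMr// (mulrC (theta / 2)) -ltr_pdivrMr ?divr_gt0// invf_div mulrA (mulrC _ 2).
  exact: truncnS_gt.
pose N := (n * n)%N.
have [M [C [M0 sC]]] := schottky_sandwiches N.
pose L := `|C| * 3 + 5 * delta + 2 / theta + 1.
have thetaV : 0 < theta^-1 by rewrite invr_gt0.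
have Cabs := ler_norm C; have C0 := normr_ge0 C.
have [T [s_fwd s_bwd s_long]] := sC L.
exists N, M, T => s; split => //.
  move=> i j /(congr1 (fun f : Isom X => f o)) sij; apply/eqP/negPn/negP => ij.
  have := s_fwd i j ij; rewrite -/(s i) -/(s j) sij gpE mdistxx.
  by have := s_long j; rewrite -/(s j) /L; move: delta_ge0; lra.
move=> l l0; have CL : 2 * C + 3 * delta < L by rewrite /L; move: delta_ge0; lra.
apply: le_trans (schottky_energy delta o delta_ge0 hyp N s C L s_fwd s_bwd s_long CL l
  n%:R _ l0) _ => //.
apply: ler_wpM2r; first exact: energy_ge0.
rewrite -/c; have n0 : (0 : R) < n%:R by [].
have Nn : N%:R = n%:R ^+ 2 :> R by rewrite /N natrM expr2.
set G := 2 * _.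
have eG : expR (- G) <= theta / 2.
  have G0 : 2 / theta <= G by rewrite /G /L; move: delta_ge0; lra.
  rewrite expRN -[leRHS]invrK lef_pV2 ?posrE ?expR_gt0 ?invr_gt0 ?divr_gt0//.
  by rewrite invf_div; apply: le_trans (expR_ge1Dx _); lra.
have -> : N%:R + N%:R ^+ 2 * expR (- G) + 2 * c * (N%:R * n%:R + N%:R ^+ 2 / n%:R) =
    N%:R ^+ 2 * (n%:R ^- 2 + expR (- G) + 4 * c / n%:R).
  by rewrite Nn; field; rewrite gt_eqF.
rewrite mulrC ler_wpM2r ?sqr_ge0//.
have : n%:R ^- 2 <= n%:R^-1 :> R.
  by rewrite lef_pV2 ?posrE ?exprn_gt0// expr2 ler_peMl ?ler1n// ltW.
by move: n_large; rewrite mulrDl; lra.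
Qed.

End SchottkyWords.

(** * Exponential decay for finitely supported steps *)

Section Domination.
Context {R : realType} {X : metricType R}.
Implicit Types (l m : seq (R * X)) (W : seq (R * Isom X)) (k : X -> X -> R).

Definition convolve W l : seq (R * X) := 
  [seq (w.1 * z.1, w.2 z.2) | w : R * Isom X <- W, z : R * X <- l].

Lemma nonneg_convolve W l :
  nonneg_weights W -> nonneg_weights l -> nonneg_weights (convolve W l).
Proof.
move=> /allP W0 /allP l0; apply/allP => _ /allpairsP[[w z] [/= wW zl ->]] /=.
by rewrite mulr_ge0//; [exact: (W0 w)|exact: (l0 z)].
Qed.

Lemma pairing_convolve k W l m :
  pairing k (convolve W l) m = \sum_(w <- W) w.1 * pairing k (translate w.2 l) m.
Proof.
rewrite /pairing /convolve big_allpairs_dep /=; apply: eq_bigr => w _.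
rewrite big_map mulr_sumr; apply: eq_bigr => z _; rewrite mulr_sumr.
by apply: eq_bigr => q _; rewrite !mulrA.
Qed.

Lemma pairing_decayC l m : pairing decay l m = pairing decay m l.
Proof.
by rewrite pairing_flip; congr pairing; apply/funext => x; apply/funext => y; rewrite decayC.
Qed.

Lemma pairing_translateV (f : Isom X) l m :
  pairing decay (translate f l) m = pairing decay l (translate (f^-1)%g m).
Proof.
rewrite /pairing /translate big_map; apply: eq_bigr => p _; rewrite big_map.
by apply: eq_bigr => q _ /=; rewrite /decay -(isom_dist f p.2) isomVK.
Qed.

(** By homogeneity this amounts to a bound of [pairing decay l m] by a multiple of
    [c * sqrt (energy m)]. The least such [c] is comparable to the square root of the energy
    of [l], but unlike it this is subadditive in [l]; being invariant under
    isometries as well, it is not increased by a convolution with a probability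
    measure. *)
Definition dominated (c : R) l : Prop :=
  forall m, nonneg_weights m -> pairing decay l m <= c * (1 + energy m).

Lemma dominated_translate c (f : Isom X) l : dominated c l -> dominated c (translate f l).
Proof.
move=> lc m m0; rewrite pairing_translateV -(energy_translate (f^-1)%g m).
by apply: lc; rewrite nonneg_translate.
Qed.

(** Test the domination against [l] itself, rescaled by the factor [t] that balances the two
    terms. *)
Lemma dominated_energy c l : 0 < c -> nonneg_weights l -> dominated c l ->
  energy l <= 4 * c ^+ 2.
Proof.
move=> c0 l0 lc; pose t := (2 * c)^-1; have t0 : 0 < t by rewrite invr_gt0; lra.
have := lc (reweight (fun=> t) l).
have l1 : reweight (fun=> 1) l = l.
  by rewrite /reweight -[RHS]map_id; apply: eq_map => -[a x] /=; rewrite mul1r.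
have -> : pairing decay l (reweight (fun=> t) l) = t * energy l.
  rewrite -{1}l1 pairing_reweight /energy -pairingZ; congr pairing; apply/funext => x.
  by apply/funext => y; rewrite mul1r.
have -> : energy (reweight (fun=> t) l) = t ^+ 2 * energy l.
  by rewrite /energy pairing_reweight -pairingZ expr2.
move=> /(_ (nonneg_reweight _ _ (fun=> ltW t0) l0)).
have ct : c * t = 1 / 2 by rewrite /t; field; rewrite gt_eqF.
have -> : c * (1 + t ^+ 2 * energy l) = c + t * energy l / 2 
  by rewrite mulrDr mulr1 expr2 !mulrA ct; lra.
move=> le; have le2 : t * energy l <= 2 * c by lra.
have -> : energy l = 2 * c * (t * energy l) by rewrite mulrA -[2 * c * t]mulrA ct; lra.
by rewrite expr2; nra.
Qed.

Lemma dominated_convolve c W l : 0 <= c -> nonneg_weights W -> \sum_(w <- W) w.1 <= 1 ->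
  dominated c l -> dominated c (convolve W l).
Proof.
move=> c0 /nonneg_weightsP W0 W1 lc m m0; rewrite pairing_convolve.
have I0 : 0 <= c * (1 + energy m) by rewrite mulr_ge0// addr_ge0// energy_ge0.
apply: le_trans (_ : (\sum_(w <- W) w.1) * (c * (1 + energy m)) <= _); last first.
  by rewrite ler_piMl.
rewrite mulr_suml big_seq [leRHS]big_seq; apply: ler_sum => w wW.
by rewrite ler_wpM2l ?W0//; apply: (dominated_translate _ _ _ lc).
Qed.

(** Split off from [W] the mass [eps] at each [s i], and bound [F] by [M] on the rest. *)
Lemma sum_with_atoms_le W (N : nat) (s : 'I_N -> Isom X) (F : Isom X -> R) (M eps : R) :
  nonneg_weights W -> \sum_(w <- W) w.1 <= 1 -> injective s -> 0 <= M ->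
  (forall f, F f <= M) -> (forall i, eps <= \sum_(w <- W | w.2 == s i) w.1) ->
  \sum_(w <- W) w.1 * F w.2 <= (1 - eps * N%:R) * M + eps * \sum_i F (s i).
Proof.
move=> /nonneg_weightsP W0 W1 s_inj M0 FM atoms_s.
have gap : \sum_i eps * (M - F (s i)) <= \sum_(w <- W) w.1 * (M - F w.2).
  apply: le_trans (_ : \sum_i \sum_(w <- W | w.2 == s i) w.1 * (M - F w.2) <= _).
    apply: ler_sum => i _; under eq_bigr => w /eqP -> do [].
    by rewrite -mulr_suml ler_wpM2r// subr_ge0.
  rewrite (exchange_big_dep predT)//= big_seq [leRHS]big_seq; apply: ler_sum => w wW.
  have w0 : 0 <= w.1 * (M - F w.2) by rewrite mulr_ge0 ?W0 ?subr_ge0.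
  rewrite sumr_const -mulr_natl ler_piMl// lern1.
  by apply/card_le1_eqP => i j; rewrite !inE => wi wj; apply: s_inj; rewrite -wi -wj.
move: gap; rewrite -mulr_sumr; under [X in _ <= X -> _]eq_bigr do rewrite mulrBr.
rewrite !sumrB sumr_const card_ord -mulr_suml -mulr_natl.
have := ler_wpM2r M0 W1; lra.
Qed.

Variable delta : R.
Hypotheses (delta_ge0 : 0 <= delta) (hyp : hyperbolic_constant X delta).
Local Notation cs := (cs_constant delta).

Lemma energy_dirac (o : X) : energy [:: (1, o)] = 1.
Proof.
by rewrite /energy /pairing big_seq1 big_seq1 /decay mdistxx oppr0 expR0 !mulr1.
Qed.

Lemma dominated_dirac (o : X) : dominated cs [:: (1, o)].
Proof.
move=> m m0; have := pairing_decay_le delta delta_ge0 hyp [:: (1, o)] m 1 ltr01.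
by rewrite energy_dirac invr1 !mul1r; apply=> //=; rewrite andbT ler01.
Qed.

(** The part of [W] that is not on the family [s] does not increase the constant. On the
    family, the small energy of the sum of the translates is turned back into a domination by
    Cauchy-Schwarz, with a gain that outweighs the constant [cs] provided that
    [theta] is small compared to [cs ^ -2]. *)
Lemma dominated_contraction c W l (N : nat) (s : 'I_N -> Isom X) (theta eps : R) :
  0 < c -> (0 < N)%N -> injective s -> 0 <= theta -> 16 * cs ^+ 2 * theta <= 1 -> 0 <= eps ->
  (forall l', nonneg_weights l' ->
    \sum_i \sum_j pairing decay (translate (s i) l') (translate (s j) l') <=
    theta * N%:R ^+ 2 * energy l') ->
  nonneg_weights W -> \sum_(w <- W) w.1 <= 1 ->
  (forall i, eps <= \sum_(w <- W | w.2 == s i) w.1) ->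
  nonneg_weights l -> dominated c l -> dominated ((1 - eps * N%:R / 2) * c) (convolve W l).
Proof.
move=> c0 N0 s_inj theta0 theta_small eps0 s_contr W0 W1 atoms_s l0 lc m m0.
set M := c * (1 + energy m); have I0 := energy_ge0 m m0.
have M0 : 0 <= M by rewrite mulr_ge0 ?(ltW c0)// addr_ge0.
rewrite pairing_convolve.
apply: le_trans (sum_with_atoms_le W N s (fun f => pairing decay (translate f l) m) M eps
  W0 W1 s_inj M0 _ atoms_s) _ => [f|].
  exact: (dominated_translate _ _ _ lc).
pose S : seq (R * Isom X) := [seq (1, s i) | i <- enum 'I_N].
have S0 : nonneg_weights S by apply/allP => _ /mapP[i _ ->]; exact: ler01.
have SE k m' : pairing k (convolve S l) m' = \sum_i pairing k (translate (s i) l) m'.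
  rewrite pairing_convolve big_map big_enum /=.
  by apply: eq_bigr => i _; rewrite mul1r.
have S_energy : energy (convolve S l) <= theta * N%:R ^+ 2 * (4 * c ^+ 2).
  rewrite /energy SE; under eq_bigr do rewrite pairing_decayC SE.
  under eq_bigr do under eq_bigr do rewrite pairing_decayC.
  apply: le_trans (s_contr l l0) _; rewrite ler_wpM2l ?mulr_ge0 ?sqr_ge0//.
  exact: dominated_energy.
have cs0 : 0 < cs by exact: cs_constant_gt0.
have Nr : (0 : R) < N%:R by rewrite ltr0n.
(* balances the two terms of Cauchy-Schwarz: each gets N c / 2 *)
pose t := 2 * cs / (N%:R * c).
have t0 : 0 < t by apply: divr_gt0; exact: mulr_gt0.
have sumF : \sum_i pairing decay (translate (s i) l) m <= N%:R * M / 2.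
  rewrite -SE.
  apply: le_trans (pairing_decay_le delta delta_ge0 hyp _ _ t t0
    (nonneg_convolve _ _ S0 l0) m0) _.
  have e1 : cs * t * (theta * N%:R ^+ 2 * (4 * c ^+ 2)) =
      N%:R * c / 2 * (16 * cs ^+ 2 * theta).
    by rewrite /t; field; rewrite !gt_eqF.
  have e2 : cs * t^-1 = N%:R * c / 2 by rewrite /t; field; rewrite !gt_eqF.
  have Nc : 0 <= N%:R * c / 2 by rewrite divr_ge0// mulr_ge0// ltW.
  rewrite mulrDr (mulrA cs t) (mulrA cs t^-1) e2 /M.
  have := ler_wpM2l (ltW (mulr_gt0 cs0 t0)) S_energy; rewrite e1.
  have := ler_wpM2l Nc theta_small; lra.
have := ler_wpM2l eps0 sumF; rewrite /M; lra.
Qed.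

End Domination.

Section Words.
Context {R : realType} {X : metricType R}.
Variable p : Isom X -> R.
Hypothesis p_ge0 : forall a, 0 <= p a.
Implicit Types (A s : seq (Isom X)).

Definition word_weight s : R := \prod_(a <- s) p a.
Definition word_prod s : Isom X := (\prod_(a <- s) a)%g.

Fixpoint words A (n : nat) : seq (seq (Isom X)) :=
  if n is n'.+1 then [seq a :: s | a <- A, s <- words A n'] else [:: [::]].

Lemma mem_words A s : {subset s <= A} -> s \in words A (size s).
Proof.
elim: s => [_|a s IH sA] /=; first by rewrite inE.
apply: allpairs_f; first by apply: sA; rewrite mem_head.
by apply: IH => b bs; apply: sA; rewrite inE bs orbT.
Qed.

Lemma word_weight_cat s t : word_weight (s ++ t) = word_weight s * word_weight t.
Proof. by rewrite /word_weight big_cat. Qed.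

Lemma word_prod_cat s t : word_prod (s ++ t) = (word_prod s * word_prod t)%g.
Proof. by rewrite /word_prod big_cat. Qed.

Lemma word_weight_ge0 s : 0 <= word_weight s.
Proof. by apply: prodr_ge0. Qed.

Lemma word_weight_gt0 s : (forall a, a \in s -> 0 < p a) -> 0 < word_weight s.
Proof. by move=> s0; rewrite /word_weight big_seq; apply: prodr_gt0. Qed.

Definition word_pow s (n : nat) := flatten (nseq n s).

Lemma word_weight_pow s n : word_weight (word_pow s n) = word_weight s ^+ n.
Proof.
elim: n => [|n IH]; first by rewrite /word_weight big_nil.
by rewrite exprS -IH -word_weight_cat.
Qed.

Lemma word_prod_pow s n : word_prod (word_pow s n) = (word_prod s ^+ n)%g.
Proof.
elim: n => [|n IH]; first by rewrite /word_prod big_nil.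
by rewrite expgS -IH -word_prod_cat.
Qed.

Lemma size_word_pow s n : size (word_pow s n) = (n * size s)%N.
Proof. by rewrite size_flatten /shape map_nseq sumn_nseq mulnC. Qed.

Lemma sub_word_pow s n : {subset word_pow s n <= s}.
Proof. by move=> a /flattenP[t /nseqP[-> _]]. Qed.

(** The law of the product of [n] independent steps restricted to [A], one entry per word;
    distinct words may give the same isometry. *)
Definition step_law A n : seq (R * Isom X) :=
  [seq (word_weight s, word_prod s) | s <- words A n].

Lemma nonneg_step_law A n : nonneg_weights (step_law A n).
Proof. by apply/allP => _ /mapP[s _ ->]; exact: word_weight_ge0. Qed.

Lemma sum_step_lawS A n (F : Isom X -> R) : \sum_(w <- step_law A n.+1) w.1 * F w.2 =
  \sum_(a <- A) p a * \sum_(w <- step_law A n) w.1 * F (a * w.2)%g.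
Proof.
rewrite big_map big_allpairs_dep /=; apply: eq_bigr => a _.
rewrite big_map mulr_sumr; apply: eq_bigr => s _ /=.
by rewrite /word_weight /word_prod !big_cons mulrA.
Qed.

Lemma sum_step_lawD A m n (F : Isom X -> R) : \sum_(w <- step_law A (m + n)) w.1 * F w.2 =
  \sum_(w <- step_law A m) w.1 * \sum_(z <- step_law A n) z.1 * F (w.2 * z.2)%g.
Proof.
elim: m F => [|m IH] F.
  rewrite add0n [RHS]big_map big_seq1 /= /word_weight /word_prod !big_nil mul1r.
  by apply: eq_bigr => z _; rewrite mul1g.
rewrite addSn sum_step_lawS.
rewrite (sum_step_lawS A m (fun f => \sum_(z <- step_law A n) z.1 * F (f * z.2)%g)).
apply: eq_bigr => a _; rewrite (IH (fun f => F (a * f)%g)); congr (_ * _).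
apply: eq_bigr => w _; congr (_ * _).
by apply: eq_bigr => z _; rewrite mulgA.
Qed.

Lemma step_law_mass A n : \sum_(a <- A) p a <= 1 -> \sum_(w <- step_law A n) w.1 <= 1.
Proof.
move=> A1; have E k : \sum_(w <- step_law A k) w.1 = \sum_(w <- step_law A k) w.1 * 1.
  by apply: eq_bigr => w _; rewrite mulr1.
rewrite E; elim: n => [|n IH].
  by rewrite big_map big_seq1 mulr1 /= /word_weight big_nil.
rewrite (sum_step_lawS A n (fun=> 1)); apply: le_trans A1; apply: ler_sum => a _.
by rewrite ler_piMr.
Qed.

Lemma step_law_atom A s : {subset s <= A} ->
  word_weight s <= \sum_(w <- step_law A (size s) | w.2 == word_prod s) w.1.
Proof.
move=> sA; rewrite big_map (big_rem s (mem_words _ _ sA)) /= eqxx lerDl.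
by apply: sumr_ge0 => t _; exact: word_weight_ge0.
Qed.

Lemma dominated_step_lawD A c m n (l : seq (R * X)) :
  dominated c (convolve (step_law A (m + n)) l) <->
  dominated c (convolve (step_law A m) (convolve (step_law A n) l)).
Proof.
suff e q : pairing decay (convolve (step_law A (m + n)) l) q =
    pairing decay (convolve (step_law A m) (convolve (step_law A n) l)) q.
  by split=> h q q0; [rewrite -e|rewrite e]; exact: h.
rewrite !pairing_convolve.
rewrite (sum_step_lawD A m n (fun f => pairing decay (translate f l) q)).
apply: eq_bigr => w _; rewrite pairing_translateV pairing_convolve; congr (_ * _).
apply: eq_bigr => z _; rewrite -pairing_translateV; congr (_ * pairing _ _ _).
by rewrite /translate -map_comp.
Qed.

Variables (delta : R) (o : X).
Hypotheses (delta_ge0 : 0 <= delta) (hyp : hyperbolic_constant X delta).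
Variables su sv : seq (Isom X).
Hypotheses (su_gt0 : forall a, a \in su -> 0 < p a) (sv_gt0 : forall a, a \in sv -> 0 < p a)
  (su_nonempty : su != [::])
  (u_esc : escaping o (word_prod su)) (v_esc : escaping o (word_prod sv))
  (uv_ends : fixed_at_infinity o (word_prod su) `&` fixed_at_infinity o (word_prod sv) = set0).

(** The constants are the same for all finite sets [A] of steps that contain the letters of
    [su] and [sv]: the Schottky family and the probability of its words only involve these
    letters. This uniformity is what allows steps of arbitrary size. *)
Lemma expected_decay : exists (k : nat) (r C : R), [/\ (0 < k)%N, 0 < r, r < 1, 0 < C &
  forall A, {subset su <= A} -> {subset sv <= A} -> \sum_(a <- A) p a <= 1 -> forall n,
    \sum_(w <- step_law A n) w.1 * decay (w.2 o) o <= C * r ^+ (n %/ k)].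
Proof.
set cs := cs_constant delta; have cs0 : 0 < cs by exact: cs_constant_gt0.
pose theta := (16 * cs ^+ 2)^-1.
have theta0 : 0 < theta by rewrite invr_gt0; apply: mulr_gt0 => //; exact: exprn_gt0.
have [N [M [T [N0 M0 s_inj s_contr]]]] := schottky_contraction delta o delta_ge0 hyp
  (word_prod su) (word_prod sv) u_esc v_esc uv_ends theta theta0.
set s := fun i : 'I_N => _ in s_inj s_contr.
pose word i := word_pow su (i * M) ++ word_pow sv T ++ word_pow su ((N - i) * M).
pose k := ((N * M) * size su + T * size sv)%N.
pose weight := word_weight su ^+ (N * M) * word_weight sv ^+ T.
have word_s (i : 'I_N) : word_prod (word i) = s i.
  by rewrite /word !word_prod_cat !word_prod_pow mulgA.
have word_k (i : 'I_N) : size (word i) = k.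
  have iN := ltnW (ltn_ord i).
  rewrite /word !size_cat !size_word_pow addnCA addnC -mulnDl -mulnDl subnKC//.
have word_w (i : 'I_N) : word_weight (word i) = weight.
  have iN := ltnW (ltn_ord i).
  rewrite /word !word_weight_cat !word_weight_pow mulrCA mulrC -exprD -mulnDl subnKC//.
have weight0 : 0 < weight by rewrite mulr_gt0 ?exprn_gt0 ?word_weight_gt0.
have Nr : (0 : R) < N%:R by rewrite ltr0n.
(* the second term only ensures that the contraction factor is positive *)
pose eps := Num.min weight N%:R^-1.
have eps0 : 0 < eps by rewrite lt_min weight0 invr_gt0.
have epsN : eps * N%:R <= 1 by rewrite -ler_pdivlMr// div1r ge_min lexx orbT.
have epsN0 : 0 < eps * N%:R by rewrite mulr_gt0.
exists k, (1 - eps * N%:R / 2), (cs * 2); split.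
- by rewrite addn_gt0 !muln_gt0 N0 M0 lt0n size_eq0 su_nonempty.
- by lra.
- by lra.
- exact: mulr_gt0.
move=> A suA svA A1 n; set r := 1 - _; have r0 : 0 < r by rewrite /r; lra.
have block c l : 0 < c -> nonneg_weights l -> dominated c l ->
    dominated (r * c) (convolve (step_law A k) l).
  move=> c0 l0 lc; apply: (dominated_contraction delta delta_ge0 hyp c (step_law A k) l N s
    theta eps) => //; [exact: ltW| |exact: ltW|exact: nonneg_step_law|exact: step_law_mass|].
    by rewrite /theta mulfV// gt_eqF//; apply: mulr_gt0 => //; exact: exprn_gt0.
  move=> i; apply: le_trans (_ : word_weight (word i) <= _).
    by rewrite word_w ge_min lexx.
  rewrite -word_s -(word_k i); apply: step_law_atom => a.
  by rewrite !mem_cat => /or3P[] /sub_word_pow; [exact: suA|exact: svA|exact: suA].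
pose dirac : seq (R * X) := [:: (1, o)].
have dirac0 : nonneg_weights dirac by rewrite /= ler01.
have blocks q : dominated (cs * r ^+ q) (convolve (step_law A (q * k + n %% k)) dirac).
  elim: q => [|q IH].
    rewrite mulr1; apply: dominated_convolve => //; first exact: ltW.
    - exact: nonneg_step_law.
    - exact: step_law_mass.
    exact: dominated_dirac.
  rewrite mulSn -addnA exprS mulrCA; apply/dominated_step_lawD; apply: block => //.
    by apply: mulr_gt0 => //; exact: exprn_gt0.
  by apply: nonneg_convolve => //; exact: nonneg_step_law.
have := blocks (n %/ k)%N dirac dirac0; rewrite -divn_eq pairing_convolve.
rewrite energy_dirac [X in _ <= X -> _]mulrAC; apply: le_trans.
rewrite le_eqVlt; apply/orP; left; apply/eqP; apply: eq_bigr => w _.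
by rewrite /pairing !big_seq1 /= !mul1r.
Qed.

End Words.

(** * From random variables to finite words *)

Section Truncation.
Context {R : realType} {X : metricType R} (mu : probability (Isom X) R).
Implicit Types A : seq (Isom X).

Definition atom_mass (a : Isom X) : R := fine (mu [set a]).

Lemma atom_massE a : (atom_mass a)%:E = mu [set a].
Proof. by rewrite /atom_mass fineK// fin_num_measure. Qed.

Lemma atom_mass_ge0 a : 0 <= atom_mass a.
Proof. by rewrite -lee_fin atom_massE. Qed.

Lemma atom_mass_seq A : uniq A -> (\sum_(a <- A) atom_mass a)%:E = mu [set` A].
Proof.
elim: A => [_|a A IH /= /andP[aA uA]].
  by rewrite big_nil (_ : [set` [::]] = set0) ?measure0//; apply/seteqP; split.
have -> : [set` a :: A] = [set a] `|` [set` A].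
  apply/seteqP; split=> b /=; rewrite in_cons; first by move=> /predU1P.
  by move=> bA; apply/predU1P.
rewrite big_cons EFinD IH// atom_massE measureU//.
by apply/seteqP; split=> // b /= [-> /= bA]; rewrite bA in aA.
Qed.

Lemma atom_mass_sum_le1 A : uniq A -> \sum_(a <- A) atom_mass a <= 1.
Proof. by move=> uA; rewrite -lee_fin atom_mass_seq// probability_le1. Qed.

(** Enumerate a countable set of full measure and use continuity from below. *)
Lemma truncation (A0 : seq (Isom X)) (eta : R) : discrete_probability mu -> 0 < eta ->
  exists A, [/\ uniq A, {subset A0 <= A} & (mu (~` [set` A]) <= eta%:E)%E].
Proof.
move=> [S /countable_injP[f f_inj] S1] eta0.
(* a left inverse of f on S: an enumeration of S *)
pose e n := xget 1%g [set x | S x /\ f x = n].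
have ef x : S x -> e (f x) = x.
  move=> Sx; have [] := xgetPex 1%g (ex_intro (fun y => S y /\ f y = f x) x (conj Sx erefl)).
  by rewrite -/(e (f x)) => Se; apply: f_inj; rewrite inE.
pose F k : set (Isom X) := [set` [seq e i | i <- iota 0 k]].
have F_cover : S `<=` \bigcup_k F k.
  move=> x Sx; exists (f x).+1 => //.
  have : x \in [seq e i | i <- iota 0 (f x).+1].
    by apply/mapP; exists (f x); [rewrite mem_iota add0n /=|rewrite ef].
  by [].
have F_mono : {homo F : n m / (n <= m)%N >-> (n <= m)%O}.
  move=> n m nm; apply/subsetPset => x /= /mapP[i].
  by rewrite !mem_iota /= => ni ->; apply: map_f; rewrite mem_iota /= (leq_trans ni).
have F1 : mu (\bigcup_k F k) = 1%E.
  apply/eqP; rewrite eq_le probability_le1//= -S1; apply: le_measure => //; rewrite inE //.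
have big : nbhs (mu (\bigcup_k F k)) [set y | ((1 - eta)%:E < y)%E].
  rewrite F1; apply: (@nbhs_open_ereal_gt R 1 (fun=> 1 - eta)).
  by rewrite ltrBlDr ltrDl.
have [k _ Fk] := @nondecreasing_cvg_mu _ _ _ mu F (fun=> I) I F_mono _ big.
have {}Fk : ((1 - eta)%:E < mu (F k))%E by apply: (Fk k) => /=.
exists (undup (A0 ++ [seq e i | i <- iota 0 k])); split.
- exact: undup_uniq.
- by move=> a aA; rewrite mem_undup mem_cat aA.
apply: le_trans (_ : mu (~` F k) <= _)%E.
  apply: le_measure; rewrite ?inE//; apply: subsetC => a Fa.
  by rewrite /= mem_undup mem_cat; apply/orP; right.
rewrite probability_setC//; have fk : mu (F k) \is a fin_num by rewrite fin_num_measure.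
move: Fk; rewrite -(fineK fk) -EFinB !lte_fin lee_fin; lra.
Qed.

End Truncation.

Section Cylinders.
Context {R : realType} {X : metricType R} (mu : probability (Isom X) R).
Context {d : measure_display} {Omega : measurableType d} (P : probability Omega R).
Variable g : nat -> {RV P >-> Isom X}.
Hypotheses (g_law : forall i, distribution P (g i) = mu :> (set (Isom X) -> \bar R))
  (g_indep : independent_rvs g).
Implicit Types (s : seq (Isom X)) (w : Omega).

Definition cylinder s : set Omega :=
  [set w | forall i, (i < size s)%N -> g i w = nth 1%g s i].

Lemma measurable_step i (B : set (Isom X)) : measurable (g i @^-1` B).
Proof. exact: measurable_funPTI. Qed.

Let J n : {fset nat} := [fset i | i in iota 0 n]%fset.

Let mem_J n i : (i \in J n) = (i < n)%N.
Proof. by rewrite in_fset /= mem_iota add0n. Qed.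

Let cylinderE s : cylinder s = \bigcap_(i in [set` J (size s)]) (g i @^-1` [set nth 1%g s i]).
Proof.
apply/seteqP; split=> w /= sw i /=; first by rewrite mem_J; exact: sw.
by move=> si; apply: sw; rewrite /= mem_J.
Qed.

Lemma measurable_cylinder s : measurable (cylinder s).
Proof.
by rewrite cylinderE; apply: bigcap_measurableType => i _; exact: measurable_step.
Qed.

Lemma probability_cylinder s : P (cylinder s) = (word_weight (atom_mass mu) s)%:E.
Proof.
rewrite cylinderE g_indep//.
have step i : P (g i @^-1` [set nth 1%g s i]) = (atom_mass mu (nth 1%g s i))%:E.
  by rewrite atom_massE -(g_law i).
under eq_bigr do rewrite step.
rewrite prodEFin; congr (_%:E); rewrite /word_weight (big_nth 1%g) /index_iota subn0.
apply: perm_big; apply: uniq_perm; rewrite ?fset_uniq ?iota_uniq// => i.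
by rewrite mem_J mem_iota add0n.
Qed.

Lemma random_walk_cylinder s w : cylinder s w -> random_walk g (size s) w = word_prod s.
Proof.
move=> sw; rewrite /random_walk /word_prod (big_nth 1%g) big_mkord.
by apply: eq_bigr => i _; exact: sw.
Qed.

Lemma outer_bigsetU_le {I : Type} (r : seq I) (F : I -> set Omega) :
  (P^*%mu (\big[setU/set0]_(i <- r) F i) <= \sum_(i <- r) P^*%mu (F i))%E.
Proof.
elim: r => [|i r IH]; first by rewrite !big_nil outer_measure0.
rewrite !big_cons; apply: le_trans (outer_measureU2 _ _ _) _.
exact: leeD2l.
Qed.

(** Either one of the first [n] steps leaves [A], or the walk follows one of the finitely many
    words over [A]. *)
Lemma outer_walk_le (A : seq (Isom X)) (eta : R) (n : nat) (B : set (Isom X)) :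
  (mu (~` [set` A]) <= eta%:E)%E ->
  (P^*%mu [set w | B (random_walk g n w)] <=
   (n%:R * eta + \sum_(s <- words A n | `[< B (word_prod s) >]) word_weight (atom_mass mu) s)%:E)%E.
Proof.
move=> Aeta; rewrite EFinD.
pose U : set Omega := \big[setU/set0]_(i <- iota 0 n) (g i @^-1` (~` [set` A])).
pose V : set Omega := \big[setU/set0]_(s <- [seq s <- words A n | `[< B (word_prod s) >]])
  cylinder s.
have cover : [set w | B (random_walk g n w)] `<=` U `|` V.
  move=> w /= Bw; have [nA|inA] := pselect (exists2 i, (i < n)%N & g i w \notin A).
    left; case: nA => i ni giA; rewrite /U -bigcup_seq; exists i; last exact/negP.
    by rewrite /= mem_iota.
  right; pose s := [seq g i w | i <- iota 0 n].
  have sn : size s = n by rewrite size_map size_iota.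
  have sw : cylinder s w.
    by move=> i; rewrite sn => ni; rewrite (nth_map 0%N) ?size_iota// nth_iota.
  rewrite /V -bigcup_seq; exists s => //=; rewrite mem_filter; apply/andP; split.
    by apply/asboolP; rewrite -(random_walk_cylinder _ _ sw) sn.
  rewrite -[X in words A X]sn; apply: mem_words => a /mapP[i]; rewrite mem_iota /= => ni ->.
  by apply: contrapT => /negP giA; apply: inA; exists i.
apply: le_trans (le_mu_ext P cover) _; apply: le_trans (outer_measureU2 _ _ _) _.
apply: leeD.
  apply: le_trans (outer_bigsetU_le _ _) _.
  apply: le_trans (_ : \sum_(i <- iota 0 n) eta%:E <= _)%E.
    apply: lee_sum => i _; rewrite measurable_mu_extE; last exact: measurable_step.
    by have := Aeta; rewrite -(g_law i).
  by rewrite sumEFin lee_fin big_const_seq count_predT size_iota iter_addr_0 mulr_natl.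
apply: le_trans (outer_bigsetU_le _ _) _.
rewrite big_filter -sumEFin; apply: lee_sum => s _.
rewrite measurable_mu_extE; last exact: measurable_cylinder.
by rewrite -[leLHS]/(P (cylinder s)) probability_cylinder.
Qed.

End Cylinders.

(** * Escape with exponential probability *)

Section Conclusion.
Context {R : realType} {X : metricType R} (o : X) (mu : probability (Isom X) R).
Context {d : measure_display} {Omega : measurableType d} (P : probability Omega R).
Variable g : nat -> {RV P >-> Isom X}.
Hypotheses (g_law : forall i, distribution P (g i) = mu :> (set (Isom X) -> \bar R))
  (g_indep : independent_rvs g).
Implicit Types s : seq (Isom X).
Local Notation p := (atom_mass mu).

Lemma atoms_gt0 a : atoms mu a -> 0 < p a.
Proof. by rewrite /atoms /= -atom_massE lte_fin. Qed.

Lemma generated_semigroup_word f : generated_semigroup (atoms mu) f ->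
  exists s, [/\ s != [::], forall a, a \in s -> 0 < p a & word_prod s = f].
Proof.
pose W := [set h | exists s, [/\ s != [::], forall a, a \in s -> 0 < p a & word_prod s = h]].
move=> /(_ W); apply; split=> [f1 f2 [s1 [n1 h1 <-]] [s2 [n2 h2 <-]]|a aP].
  exists (s1 ++ s2); split; last exact: word_prod_cat.
    by rewrite -size_eq0 size_cat addn_eq0 negb_and size_eq0 n1.
  by move=> a; rewrite mem_cat => /orP[/h1|/h2].
exists [:: a]; split=> //; last by rewrite /word_prod big_seq1.
by move=> b; rewrite mem_seq1 => /eqP ->; exact: atoms_gt0.
Qed.

(** Markov's inequality for [exp (- d)] over the words in a finite set of steps, which is then
    enlarged until the remaining steps have negligible probability. *)
Lemma walk_tail : gromov_hyperbolic X -> discrete_probability mu -> non_elementary o mu ->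
  exists beta C : R, [/\ 0 < beta, 0 < C & forall (n : nat) (rho : R),
    (P^*%mu [set w | mdist o (random_walk g n w o) <= rho]%R <=
     (C * expR (rho - beta * n%:R))%:E)%E].
Proof.
move=> [delta delta0 hyp] mu_disc [u [v [/generated_semigroup_word[su [su_ne su0 <-]]
  /generated_semigroup_word[sv [_ sv0 <-]] /loxodromic_escaping u_esc
  /loxodromic_escaping v_esc uv]]].
have [k [r [C [k0 r0 r1 C0 tail]]]] := expected_decay p (atom_mass_ge0 mu) delta o delta0 hyp
  su sv su0 sv0 su_ne u_esc v_esc uv.
have kr : (0 : R) < k%:R by rewrite ltr0n.
pose beta := - ln r / k%:R.
have lnr : ln r < 0 by rewrite -ln1 ltr_ln ?posrE.
have beta0 : 0 < beta by rewrite divr_gt0// oppr_gt0.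
have rE q : r ^+ q = expR (q%:R * - (beta * k%:R)).
  have -> : - (beta * k%:R) = ln r by rewrite /beta; field; rewrite gt_eqF.
  by rewrite expRM_natl lnK.
clearbody beta.
exists beta, (C * expR (beta * k%:R)); split=> //; first by rewrite mulr_gt0 ?expR_gt0.
move=> n rho; apply: le_trans (_ : ((C * r ^+ (n %/ k)) * expR rho)%:E <= _)%E; last first.
  rewrite lee_fin -!mulrA ler_wpM2l ?(ltW C0)//.
  rewrite rE -!expRD ler_expR.
  have : (n%:R : R) <= (n %/ k)%:R * k%:R + k%:R.
    by rewrite -natrM -natrD ler_nat {1}(divn_eq n k) leq_add2l ltnW// ltn_pmod.
  by move=> h; have := ler_wpM2l (ltW beta0) h; lra.
apply/lee_addgt0Pr => e e0; have n1 : (0 : R) < n.+1%:R by [].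
have [A [uA subA Aeta]] := truncation mu (su ++ sv) (e / n.+1%:R) mu_disc (divr_gt0 e0 n1).
apply: le_trans (outer_walk_le mu P g g_law g_indep A _ n
  (fun f => mdist o (f o) <= rho) Aeta) _.
rewrite -EFinD lee_fin addrC; apply: lerD; last first.
  rewrite mulrCA ger_pMr// ler_pdivrMr// mul1r ler_nat leqnSn//.
have suA : {subset su <= A} by move=> a asu; apply: subA; rewrite mem_cat asu.
have svA : {subset sv <= A} by move=> a asv; apply: subA; rewrite mem_cat asv orbT.
have := tail A suA svA (atom_mass_sum_le1 mu A uA) n.
move=> /(ler_wpM2r (expR_ge0 rho)); apply: le_trans.
rewrite big_map mulr_suml big_mkcond /=; apply: ler_sum => s _.
have w0 := word_weight_ge0 p (atom_mass_ge0 mu) s.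
case: ifP => [/asboolP le|_]; last by rewrite !mulr_ge0 ?expR_ge0.
rewrite -mulrA ler_peMr// /decay -expRD -[leLHS]expR0 ler_expR metric_sym; lra.
Qed.

(** The bound of [walk_tail] may be void for small [n], where a mere gap is needed. If all words of
    length [n] in the atoms fixed [o], so would all words whose length is a multiple of [n],
    among them powers of a loxodromic element. *)
Lemma short_walk (n : nat) : non_elementary o mu -> (0 < n)%N ->
  exists q : R, 0 < q /\ forall rho, rho < q ->
    (P^*%mu [set w | mdist o (random_walk g n w o) <= rho]%R <= (1 - q)%:E)%E.
Proof.
move=> [u [_ [/generated_semigroup_word[su [su_ne su0 <-]] _ /loxodromic_escaping u_esc _ _]]] n0.
have [s [sn s0 so]] : exists s, [/\ size s = n, forall a, a \in s -> 0 < p a &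
    0 < mdist o (word_prod s o)].
  apply: contrapT => none.
  have fix_n s : size s = n -> (forall a, a \in s -> 0 < p a) -> word_prod s o = o.
    move=> sn s0; apply: contrapT => so; apply: none; exists s; split=> //.
    by rewrite mdist_gt0; apply/eqP => /esym.
  have fix_mul m s : size s = (m * n)%N -> (forall a, a \in s -> 0 < p a) -> word_prod s o = o.
    elim: m s => [|m IH] s sm s0.
      by have -> : s = [::] by [apply/size0nil; rewrite sm]; rewrite /word_prod big_nil.
    rewrite -(cat_take_drop n s) word_prod_cat isomM IH ?fix_n//.
    - by rewrite size_takel// sm mulSn leq_addr.
    - by move=> a /mem_take/s0.
    - by rewrite size_drop sm mulSn addKn.
    - by move=> a /mem_drop/s0.
  have [M uM] := escaping_far o (word_prod su) 1 u_esc.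
  have := uM (M * n)%N (leq_pmulr _ n0); rewrite -word_prod_pow.
  rewrite (fix_mul (M * size su)%N) ?mdistxx ?ler10//.
    by rewrite size_word_pow mulnAC.
  by move=> a /sub_word_pow/su0.
have w0 : 0 < word_weight p s by exact: word_weight_gt0.
(* one number serves both as a distance and as a probability *)
pose q := Num.min (mdist o (word_prod s o)) (word_weight p s).
exists q; split; first by rewrite lt_min so.
move=> rho rq; apply: le_trans (_ : P^*%mu (~` cylinder P g s) <= _)%E.
  apply: le_mu_ext => w /= wrho sw; have := random_walk_cylinder P g s w sw; rewrite sn => e.
  by move: wrho rq; rewrite e lt_min => h /andP[]; rewrite ltNge h.
have ms : measurable (cylinder P g s) by exact: measurable_cylinder.
rewrite measurable_mu_extE; last exact: measurableC.
rewrite -[leLHS]/(P (~` cylinder P g s)) probability_setC//.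
rewrite (probability_cylinder mu P g g_law g_indep) -EFinB lee_fin.
by rewrite lerD2l lerN2 ge_min lexx orbT.
Qed.

Lemma short_walks (m : nat) : non_elementary o mu ->
  exists kappa0 : R, 0 < kappa0 /\ forall kappa, 0 < kappa -> kappa <= kappa0 ->
    forall n, (n < m)%N ->
    (P^*%mu [set w | mdist o (random_walk g n w o) <= kappa * n%:R]%R
        <= (expR (- (kappa * n%:R)))%:E)%E.
Proof.
move=> ne; elim: m => [|m [k0 [k00 IH]]]; first by exists 1; split.
have [->|m0] := posnP m.
  exists 1; split=> // kappa _ _ [|//] _; rewrite mulr0 oppr0 expR0.
  by apply: le_trans (le_mu_ext P (@subsetT _ _)) _; rewrite measurable_mu_extE ?probability_le1.
have [q [q0 mq]] := short_walk m ne m0; have mr : (0 : R) < m%:R by rewrite ltr0n.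
exists (Num.min k0 (q / (2 * m%:R))); split; first by rewrite lt_min k00 divr_gt0 ?mulr_gt0.
move=> kappa kappa0; rewrite le_min => /andP[kk kq] n.
rewrite ltnS leq_eqVlt => /orP[/eqP ->|nm]; last exact: IH.
have kmq : kappa * m%:R <= q / 2.
  by move: kq; rewrite invfM mulrA -ler_pdivlMr// => h; apply: le_trans h _.
apply: le_trans (mq _ _) _; first by lra.
by rewrite lee_fin; apply: le_trans (expR_ge1Dx _); lra.
Qed.

End Conclusion.

Theorem theorem1p1 (R : realType) (X : metricType R) (o : X)
    (hX : gromov_hyperbolic X)
    (mu : probability (Isom X) R)
    (mu_discrete : discrete_probability mu)
    (mu_nonelem : non_elementary o mu)
    (d : measure_display) (Omega : measurableType d)
    (P : probability Omega R)
    (g : nat -> {RV P >-> Isom X})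
    (g_law : forall i, distribution P (g i) = mu :> (set (Isom X) -> \bar R))
    (g_indep : independent_rvs g) :
  exists2 kappa : R, 0 < kappa &
    forall n : nat,
      (P^*%mu [set w | mdist o (random_walk g n w o) <= kappa * n%:R]%R
        <= (expR (- (kappa * n%:R)))%:E)%E.
Proof.
have [beta [C [beta0 C0 tail]]] := walk_tail o mu P g g_law g_indep hX mu_discrete mu_nonelem.
pose m := (Num.truncn (2 * C / beta)).+1.
have [k0 [k00 short]] := short_walks o mu P g g_law g_indep m mu_nonelem.
exists (Num.min k0 (beta / 4)); first by rewrite lt_min k00 divr_gt0.
set kappa := Num.min _ _ => n.
have kappa0 : 0 < kappa by rewrite lt_min k00 divr_gt0.
have [nm|mn] := ltnP n m; first by apply: short => //; rewrite ge_min lexx.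
apply: le_trans (tail n _) _; rewrite lee_fin.
have kb : kappa <= beta / 4 by rewrite ge_min lexx orbT.
have Cn : 2 * C <= beta * n%:R.
  rewrite (mulrC beta) -ler_pdivrMr//; apply: le_trans (ltW (truncnS_gt _)) _.
  by rewrite ler_nat.
have CE : C <= expR (beta * n%:R / 2) by apply: le_trans (expR_ge1Dx _); lra.
apply: le_trans (ler_wpM2r (expR_ge0 _) CE) _; rewrite -expRD ler_expR.
have : kappa * n%:R <= beta / 4 * n%:R by rewrite ler_wpM2r.
lra.
Qed.
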